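(* Let $X$ be a compact, locally $\mathrm{CAT}(0)$, geodesic metric space with fundamental group not isomorphic to $\mathbb{Z}$ and with topologically transitive geodesic flow on its space of geodesics $GX$. If there exists an orbit semi-equivalence $h:\mathrm{Susp}(\Sigma,\sigma)\to GX$, where $(\Sigma,\sigma)$ is a compact subshift of finite type, then the geodesic flow on $GX$ satisfies the weak specification property.
   Context: A geodesic metric space is $\mathrm{CAT}(0)$ if for every geodesic triangle with comparison triangle in the Euclidean plane (same side lengths), distances between points on the triangle are at most the distances between the comparison points; it is locally $\mathrm{CAT}(0)$ if every point has a $\mathrm{CAT}(0)$ neighborhood. Let $\tilde X$ be the universal cover of $X$. $GX$ is the set of locally isometric maps $\gamma:\mathbb{R}\to X$, with geodesic flow $(g_t\gamma)(s)=\gamma(s+t)$ and metric $d_{GX}(\gamma_1,\gamma_2)=\inf_{\tilde\gamma_1,\tilde\gamma_2}\int_{-\infty}^{\infty}d_{\tilde X}(\tilde\gamma_1(t),\tilde\gamma_2(t))e^{-2|t|}dt$ (infimum over lifts to $\tilde X$). A (two-sided) subshift of finite type is a closed shift-invariant subset $\Sigma\subset\mathcal{A}^{\mathbb{Z}}$, $\mathcal{A}$ a finite alphabet, described by a finite set of forbidden words, with the left shift $\sigma$. $\mathrm{Susp}(\Sigma,\sigma)$ is the space $(\Sigma\times[0,1])/\sim$, $(x,1)\sim(\sigma x,0)$, with the flow given locally by $\phi_t(x,s)=(x,s+t)$. A continuous flow $(Z_2,\{g_s\})$ is orbit semi-equivalent to a continuous flow $(Z_1,\{f_s\})$ if there is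 a continuous surjection $h:Z_1\to Z_2$ (the orbit semi-equivalence) whose restriction to any $\{f_s\}$-orbit is an orientation-preserving local homeomorphism onto a $\{g_s\}$-orbit. A flow $\{f_s\}$ on a compact metric space $(Z,d)$ is topologically transitive if for all nonempty open $U,V$ there is $t\ge0$ with $f_tU\cap V\ne\emptyset$. It has weak specification if for every $\delta>0$ there exists $\tau>0$ such that for every finite collection $\{(x_i,t_i)\}_{i=1}^k\subset Z\times[0,\infty)$ ($k\ge1$) there exist $y\in Z$ and $\tau_1,\dots,\tau_{k-1}\in[0,\tau]$ such that, with $s_j=\sum_{i=1}^jt_i+\sum_{i=1}^{j-1}\tau_i$ and $s_0=\tau_0=0$, one has $d(f_{s}f_{s_{j-1}+\tau_{j-1}}y,f_sx_j)<\delta$ for all $s\in[0,t_j]$ and every $1\le j\le k$. *)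

(* Defs.v *)
From HB Require Import structures.
From Stdlib Require Import Relations.Relation_Operators.
From mathcomp Require Import all_boot all_order all_algebra generic_quotient.
From mathcomp Require Import all_classical all_reals all_analysis.
From mathcomp Require Import lra.

Set Implicit Arguments.
Unset Strict Implicit.
Unset Printing Implicit Defensive.

Import Order.TTheory GRing.Theory Num.Theory.
Import numFieldNormedType.Exports.

Local Open Scope classical_set_scope.
Local Open Scope ring_scope.

Section CAT0.
Context {R : realType} {X : metricType R}.

(* [c], restricted to [0, d(x, y)], is a geodesic from [x] to [y] inside [U]. *)
Definition geodesic_segment (U : set X) (x y : X) (c : R -> X) : Prop :=
  [/\ c 0 = x, c (mdist x y) = y, {in `[0, mdist x y], forall t, U (c t)} &
      {in `[0, mdist x y] &, forall s t, mdist (c s) (c t) = `|s - t|}].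

Definition geodesic_set (U : set X) : Prop :=
  forall x y, U x -> U y -> exists c, geodesic_segment U x y c.

(* The Euclidean distance; the library's norm on [R * R] is the sup norm. *)
Definition euclid_dist (a b : R * R) : R :=
  Num.sqrt ((a.1 - b.1) ^+ 2 + (a.2 - b.2) ^+ 2).

(* The side number [i] of a triangle goes from vertex [i] to vertex
   [ordS i] = i + 1 mod 3.  In the comparison triangle [w], the point [P] is the
   comparison point of the point [c i s] when it lies on the segment from [w i]
   to [w (ordS i)] at distance [s] from [w i]. *)
Definition comparison_point (v : 'I_3 -> X) (w : 'I_3 -> R * R)
    (i : 'I_3) (s : R) (P : R * R) : Prop :=
  euclid_dist (w i) P = s /\
  euclid_dist P (w (ordS i)) = mdist (v i) (v (ordS i)) - s.

Definition CAT0_inequality (U : set X) : Prop :=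
  forall (v : 'I_3 -> X) (c : 'I_3 -> R -> X) (w : 'I_3 -> R * R),
    (forall i, U (v i)) ->
    (forall i, geodesic_segment U (v i) (v (ordS i)) (c i)) ->
    (forall i j, euclid_dist (w i) (w j) = mdist (v i) (v j)) ->
    forall (i j : 'I_3) (s t : R) (P Q : R * R),
      s \in `[0, mdist (v i) (v (ordS i))] ->
      t \in `[0, mdist (v j) (v (ordS j))] ->
      comparison_point v w i s P -> comparison_point v w j t Q ->
      mdist (c i s) (c j t) <= euclid_dist P Q.

(* The subset [U], with the induced metric, is a CAT(0) space. *)
Definition CAT0_set (U : set X) : Prop := geodesic_set U /\ CAT0_inequality U.

End CAT0.

Definition geodesic_space {R : realType} (X : metricType R) : Prop :=
  geodesic_set [set: X].

Definition locally_CAT0 {R : realType} (X : metricType R) : Prop :=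
  forall x : X, exists2 U, nbhs x U & CAT0_set U.

Section glue.
Context {R : realType} {T : topologicalType}.

Lemma within_comp {S S' : topologicalType} (phi : S -> S') (f : S' -> T)
    (A : set S) (B : set S') : continuous phi ->
  (forall x, A x -> B (phi x)) ->
  {within B, continuous f} -> {within A, continuous (fun x => f (phi x))}.
Proof.
move=> cphi AB /subspace_continuousP cf; apply/subspace_continuousP => x Ax.
apply: cvg_trans (cf _ (AB _ Ax)) => V; rewrite /= !nbhs_filterE /= => fV.
rewrite /within /=; have := cphi x _ fV; rewrite /nbhs/=.
by apply: filterS => y + Ay; apply; exact: AB.
Qed.

Lemma pair_continuous {S S' : topologicalType} (f : S -> T) (g : S -> S') :
  continuous f -> continuous g -> continuous (fun x => (f x, g x)).
Proof. by move=> cf cg x; apply: cvg_pair => /=; [exact: cf|exact: cg]. Qed.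

Lemma within_glue {S : topologicalType} (A : set S) (k : S -> R)
    (f g : S -> T) : closed A -> continuous k ->
  {within A `&` [set x | k x <= 2^-1], continuous f} ->
  {within A `&` [set x | 2^-1 <= k x], continuous g} ->
  (forall x, A x -> k x = 2^-1 -> f x = g x) ->
  {within A, continuous (fun x => if k x <= 2^-1 then f x else g x)}.
Proof.
move=> cA ck cf cg fg.
have cl1 : closed [set x | k x <= 2^-1].
  by apply: (@preimage_closed _ _ k [set y | y <= 2^-1]) => // x _; exact: ck.
have cl2 : closed [set x | 2^-1 <= k x].
  by apply: (@preimage_closed _ _ k [set y | 2^-1 <= y]) => // x _; exact: ck.
rewrite (_ : A = (A `&` [set x | k x <= 2^-1]) `|`
                 (A `&` [set x | 2^-1 <= k x])); last first.
  rewrite -setIUr (_ : _ `|` _ = setT) ?setIT//; apply/seteqP; split=> // x _ /=.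
  by case: (leP (k x) 2^-1) => [|/ltW]; [left|right].
apply: withinU_continuous; [exact: closedI..| |].
- apply: subspace_eq_continuous cf => x; rewrite inE => -[_ /= kx].
  by rewrite /from_subspace /= kx.
- apply: subspace_eq_continuous cg => x; rewrite inE => -[Ax /= kx].
  rewrite /from_subspace /=; case: ifP => // kx'; apply/esym/fg => //.
  by apply/eqP; rewrite eq_le kx kx'.
Qed.

End glue.

Section paths.
Context {R : realType} {T : topologicalType}.
Implicit Types (f g : R -> T) (x y : T).

Definition is_path f x y : Prop :=
  [/\ {within `[0, 1], continuous f}, f 0 = x & f 1 = y].

Definition path_connected_space : Prop :=
  forall x y : T, exists f : R -> T, is_path f x y.

Definition path_homotopic f g : Prop :=
  exists H : R * R -> T,
    [/\ {within `[0, 1] `*` `[0, 1], continuous H},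
        {in `[0, 1], forall s, H (0, s) = f s},
        {in `[0, 1], forall s, H (1, s) = g s} &
        {in `[0, 1], forall u, H (u, 0) = f 0 /\ H (u, 1) = f 1}].

Definition path_cat f g : R -> T :=
  fun t => if t <= 2^-1 then f (2 * t) else g (2 * t - 1).

Let half0 : ((0 : R) <= 2^-1) = true. Proof. by apply/idP; lra. Qed.
Let half1 : ((1 : R) <= 2^-1) = false. Proof. by apply/negP; lra. Qed.
Let half2 : 2 * 2^-1 = 1 :> R. Proof. by lra. Qed.
Let two1 : 2 * 1 - 1 = 1 :> R. Proof. by lra. Qed.
Let unitl (u : R) : u \in `[0, 1] -> u <= 2^-1 -> 2 * u \in `[0, 1].
Proof. by rewrite !in_itv/= => /andP[u0 _] u1; apply/andP; split; lra. Qed.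
Let unitr (u : R) : u \in `[0, 1] -> 2^-1 <= u -> 2 * u - 1 \in `[0, 1].
Proof. by rewrite !in_itv/= => /andP[_ u0] u1; apply/andP; split; lra. Qed.

Lemma is_path_cat f g x y z :
  is_path f x y -> is_path g y z -> is_path (path_cat f g) x z.
Proof.
move=> [cf f0 f1] [cg g0 g1]; split; last 2 first.
- by rewrite /path_cat half0 mulr0.
- by rewrite /path_cat half1 two1.
apply: (@within_glue R T R _ idfun (fun t => f (2 * t)) (fun t => g (2 * t - 1))).
- exact: itv_closed.
- by move=> ?; exact: cvg_id.
- apply: (@within_comp _ R R (fun t : R => 2 * t) f _ _ _ _ cf).
    by move=> t; apply: mulrl_continuous.
  by move=> t /= [? ?]; exact: unitl.
- apply: (@within_comp _ R R (fun t : R => 2 * t - 1) g _ _ _ _ cg).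
    move=> t; apply: cvgB; last exact: cvg_cst.
    exact: mulrl_continuous.
  by move=> t /= [? ?]; exact: unitr.
- by move=> t _ /= ->; rewrite half2 subrr f1 g0.
Qed.

Lemma path_homotopic_refl f :
  {within `[0, 1], continuous f} -> path_homotopic f f.
Proof.
move=> cf; exists (f \o snd); split=> //.
apply: (@within_comp _ _ _ snd f _ _ _ _ cf); first by move=> u; exact: cvg_snd.
by move=> u [].
Qed.

Let unit0 : (0 : R) \in `[0, 1]. Proof. by rewrite in_itv/= lexx ler01. Qed.
Let unit1 : (1 : R) \in `[0, 1]. Proof. by rewrite in_itv/= lexx ler01. Qed.

Lemma path_homotopic_ends f g :
  path_homotopic f g -> f 0 = g 0 /\ f 1 = g 1.
Proof.
by move=> [H [_ _ H1 He]]; rewrite -!H1//; have [-> ->] := He _ unit1.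
Qed.

Lemma path_homotopic_sym f g : path_homotopic f g -> path_homotopic g f.
Proof.
move=> fg; have [f0 f1] := path_homotopic_ends fg.
have [H [cH H0 H1 He]] := fg.
have sub1 (u : R) : u \in `[0, 1] -> 1 - u \in `[0, 1].
  by rewrite !in_itv/= => /andP[u0 u1]; rewrite subr_ge0 u1 gerBl.
exists (fun us => H (1 - us.1, us.2)); split.
- apply: (@within_comp _ _ _ (fun us : R * R => (1 - us.1, us.2)) H _ _ _ _ cH).
    apply: pair_continuous => u; last exact: cvg_snd.
    by apply: cvgB; [exact: cvg_cst|exact: cvg_fst].
  by move=> [u s] /= [us ss]; split => //=; exact: sub1.
- by move=> s ss /=; rewrite subr0 H1.
- by move=> s ss /=; rewrite subrr H0.
- by move=> u us /=; rewrite -f0 -f1; apply: He; exact: sub1.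
Qed.

Lemma path_homotopic_trans f g h :
  path_homotopic f g -> path_homotopic g h -> path_homotopic f h.
Proof.
move=> fg gh; have [f0 f1] := path_homotopic_ends fg.
have [H [cH H0 H1 He]] := fg; have [K [cK K0 K1 Ke]] := gh.
exists (fun us => if us.1 <= 2^-1 then H (2 * us.1, us.2)
                  else K (2 * us.1 - 1, us.2)); split.
- apply: (@within_glue R T _ _ fst (fun us => H (2 * us.1, us.2))
     (fun us => K (2 * us.1 - 1, us.2))).
  + by apply: closedI; apply: preimage_closed => [u _|];
      [exact: cvg_fst|exact: itv_closed|exact: cvg_snd|exact: itv_closed].
  + by move=> u; exact: cvg_fst.
  + apply: (@within_comp _ _ _ (fun us : R * R => (2 * us.1, us.2)) H _ _ _ _ cH).
      apply: pair_continuous => u; last exact: cvg_snd.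
      by apply: cvgM; [exact: cvg_cst|exact: cvg_fst].
    by move=> [u s] /= [] [us ss] u1; split => //=; exact: unitl.
  + apply: (@within_comp _ _ _ (fun us : R * R => (2 * us.1 - 1, us.2)) K _ _ _ _ cK).
      apply: pair_continuous => u; last exact: cvg_snd.
      apply: cvgB; last exact: cvg_cst.
      by apply: cvgM; [exact: cvg_cst|exact: cvg_fst].
    by move=> [u s] /= [] [us ss] u1; split => //=; exact: unitr.
  + move=> [u s] [/= _ ss] ->; rewrite half2 subrr.
    by rewrite H1// K0.
- by move=> s ss /=; rewrite half0 mulr0 H0.
- by move=> s ss /=; rewrite half1 two1 K1.
- move=> u us /=; case: ifPn => u1; first by apply: He; exact: unitl.
  rewrite f0 f1; apply: Ke; apply: unitr => //.
  by rewrite ltW// ltNge.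
Qed.

Lemma path_homotopic_cat f f' g g' : f 1 = g 0 ->
  path_homotopic f f' -> path_homotopic g g' ->
  path_homotopic (path_cat f g) (path_cat f' g').
Proof.
move=> fg0 [H [cH H0 H1 He]] [K [cK K0 K1 Ke]].
exists (fun us => if us.2 <= 2^-1 then H (us.1, 2 * us.2)
                  else K (us.1, 2 * us.2 - 1)); split.
- apply: (@within_glue R T _ _ snd (fun us => H (us.1, 2 * us.2))
     (fun us => K (us.1, 2 * us.2 - 1))).
  + by apply: closedI; apply: preimage_closed => [u _|];
      [exact: cvg_fst|exact: itv_closed|exact: cvg_snd|exact: itv_closed].
  + by move=> u; exact: cvg_snd.
  + apply: (@within_comp _ _ _ (fun us : R * R => (us.1, 2 * us.2)) H
      _ _ _ _ cH).
      apply: pair_continuous => u; first exact: cvg_fst.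
      by apply: cvgM; [exact: cvg_cst|exact: cvg_snd].
    by move=> [u s] /= [] [us ss] u1; split => //=; exact: unitl.
  + apply: (@within_comp _ _ _ (fun us : R * R => (us.1, 2 * us.2 - 1)) K
      _ _ _ _ cK).
      apply: pair_continuous => u; first exact: cvg_fst.
      apply: cvgB; last exact: cvg_cst.
      by apply: cvgM; [exact: cvg_cst|exact: cvg_snd].
    by move=> [u s] /= [] [us ss] u1; split => //=; exact: unitr.
  + move=> [u s] [/= us _] ->; rewrite half2 subrr.
    by have [_ ->] := He _ us; have [-> _] := Ke _ us.
- move=> s ss /=; rewrite /path_cat; case: ifPn => s1.
    by rewrite H0//; exact: unitl.
  by rewrite K0//; apply: unitr => //; rewrite ltW// ltNge.
- move=> s ss /=; rewrite /path_cat; case: ifPn => s1.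
    by rewrite H1//; exact: unitl.
  by rewrite K1//; apply: unitr => //; rewrite ltW// ltNge.
- move=> u us /=; rewrite /path_cat half0 half1 mulr0 two1.
  by have [-> _] := He _ us; have [_ ->] := Ke _ us.
Qed.

End paths.

Section fundamental_group.
Context (R : realType) {T : topologicalType} (x0 : T).

Record loop := Loop { loop_fun :> R -> T; loopP : is_path loop_fun x0 x0 }.

HB.instance Definition _ := gen_eqMixin loop.
HB.instance Definition _ := gen_choiceMixin loop.

Definition loop_homotopic (p q : loop) : bool := `[< path_homotopic p q >].

Lemma loop_homotopic_refl : reflexive loop_homotopic.
Proof. by move=> [p [cp p0 p1]]; apply/asboolP; exact: path_homotopic_refl. Qed.

Lemma loop_homotopic_sym : symmetric loop_homotopic.
Proof.
by move=> p q; apply/idP/idP => /asboolP pq; apply/asboolP;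
  exact: path_homotopic_sym.
Qed.

Lemma loop_homotopic_trans : transitive loop_homotopic.
Proof.
move=> q p r /asboolP pq /asboolP qr; apply/asboolP.
exact: path_homotopic_trans qr.
Qed.

Canonical loop_homotopic_equiv := EquivRel loop_homotopic
  loop_homotopic_refl loop_homotopic_sym loop_homotopic_trans.

Local Open Scope quotient_scope.

Definition pi1 : Type := {eq_quot loop_homotopic}.

HB.instance Definition _ := EqQuotient.on pi1.

Definition loop_cat (p q : loop) : loop := Loop (is_path_cat (loopP p) (loopP q)).

Definition pi1_mul (a b : pi1) : pi1 := \pi_pi1 (loop_cat (repr a) (repr b)).

Lemma pi1_mulE (p q : loop) :
  pi1_mul (\pi_pi1 p) (\pi_pi1 q) = \pi_pi1 (loop_cat p q).
Proof.
apply/eqmodP/asboolP/path_homotopic_cat.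
- by have [_ _ ->] := loopP (repr (\pi_pi1 p)); have [_ -> _] := loopP (repr (\pi_pi1 q)).
- by apply/asboolP; apply/(@eqmodP _ loop_homotopic_equiv); rewrite reprK.
- by apply/asboolP; apply/(@eqmodP _ loop_homotopic_equiv); rewrite reprK.
Qed.

Definition pi1_isomorphic_Z : Prop :=
  exists phi : pi1 -> int,
    bijective phi /\ {morph phi : a b / pi1_mul a b >-> a + b}.

End fundamental_group.

Definition simply_connected (R : realType) (T : topologicalType) : Prop :=
  @path_connected_space R T /\ forall (x : T) (a b : pi1 R x), a = b.

Section covers.
Context {R : realType} {Y X : metricType R}.

Definition curve_length (a b : R) (c : R -> X) : \bar R :=
  ereal_sup [set (let F := c \o nth b (a :: s) in
                  \sum_(0 <= n < size s) mdist (F n) (F n.+1))%:E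
            | s in itv_partition a b].

Definition evenly_covered (p : Y -> X) (U : set X) : Prop :=
  exists S : set (set Y),
    [/\ p @^-1` U = \bigcup_(V in S) V, trivIset S id &
        forall V, S V ->
          [/\ open V, set_inj V p, p @` V = U &
              forall W, open W -> W `<=` V -> open (p @` W)]].

Definition covering_map (p : Y -> X) : Prop :=
  [/\ continuous p, range p = setT &
      forall x, exists U, [/\ open U, U x & evenly_covered p U]].

(* The metric of the universal cover is the length metric induced from [X]:
   distances are infima of the lengths in [X] of the projections of paths. *)
Definition universal_cover (p : Y -> X) : Prop :=
  [/\ covering_map p, simply_connected R Y &
      forall a b : Y, (mdist a b)%:E =
        ereal_inf [set curve_length 0 1 (p \o c)
                  | c in [set c | is_path c a b]]].

End covers.

(* An alias of [T] carrying the topology of the metric [d]; the construction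
   makes sense for every [d]. *)
Definition dist_topology {R : realType} {T : Type} (d : T -> T -> R) : Type := T.

Section dist_topology.
Context {R : realType} {T : Type} (d : T -> T -> R).

HB.instance Definition _ := gen_eqMixin (dist_topology d).
HB.instance Definition _ := gen_choiceMixin (dist_topology d).

Definition dist_open : set_system (dist_topology d) :=
  [set U | forall x, U x -> exists2 e : R, 0 < e & forall y, d x y < e -> U y].

Let dist_openT : dist_open setT.
Proof. by move=> x _; exists 1. Qed.

Let dist_openI : setI_closed dist_open.
Proof.
move=> A B oA oB x [/oA[e e0 eA] /oB[f f0 fB]].
exists (Num.min e f); first by rewrite lt_min e0.
by move=> y; rewrite lt_min => /andP[/eA Ay /fB By].
Qed.

Let dist_open_bigU (I : Type) (f : I -> set (dist_topology d)) :
  (forall i, dist_open (f i)) -> dist_open (\bigcup_i f i).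
Proof.
move=> of_ x [i _ /of_[e e0 ef]]; exists e => // y /ef fiy.
by exists i.
Qed.

HB.instance Definition _ :=
  isOpenTopological.Build (dist_topology d) dist_openT dist_openI dist_open_bigU.

End dist_topology.

Definition locally_isometric {R : realType} {X : metricType R}
    (g : R -> X) : Prop :=
  forall t0 : R, exists2 e : R, 0 < e &
    forall s t, `|s - t0| < e -> `|t - t0| < e -> mdist (g s) (g t) = `|s - t|.

Record geodesic_line {R : realType} (X : metricType R) := GeodesicLine {
  line_fun :> R -> X;
  lineP : locally_isometric line_fun }.

Section GX.
Context {R : realType} {Y X : metricType R} (p : Y -> X).

Definition lift_of (g : R -> X) (g' : R -> Y) : Prop :=
  continuous g' /\ p \o g' = g.

Definition lifted_distance (g1 g2 : R -> Y) : \bar R :=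
  (\int[lebesgue_measure]_t (mdist (g1 t) (g2 t) * expR (- (2 * `|t|)))%:E)%E.

(* When [p] is a universal cover, the infimum is a real number, so that [fine]
   does not change it. *)
Definition dGX (g1 g2 : geodesic_line X) : R :=
  fine (ereal_inf [set lifted_distance g.1 g.2
                  | g in [set g | lift_of g1 g.1 /\ lift_of g2 g.2]]).

Definition GX : Type := dist_topology dGX.

HB.instance Definition _ := Topological.on GX.

Lemma shift_locally_isometric (t : R) (g : R -> X) :
  locally_isometric g -> locally_isometric (fun s => g (s + t)).
Proof.
have shiftB (x y : R) : x + t - (y + t) = x - y by lra.
move=> ig t0; have [e e0 ge] := ig (t0 + t); exists e => // u v ue ve.
by rewrite ge shiftB.
Qed.

Definition geodesic_flow (t : R) (g : GX) : GX :=
  GeodesicLine (shift_locally_isometric t (lineP g)).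

End GX.

Arguments geodesic_flow {R Y X} p t g.

Definition full_shift (A : finType) : topologicalType :=
  prod_topology (fun _ : int => discrete_topology A).

Section shifts.
Context {A : finType}.

(* [shift 1] is the left shift and [shift m] its [m]-th power. *)
Definition shift (m : int) (x : full_shift A) : full_shift A :=
  fun n => x (n + m).

Definition subword (x : full_shift A) (n : int) (k : nat) : seq A :=
  [seq (x (n + i%:Z) : A) | i <- iota 0 k].

Definition sft (W : seq (seq A)) : set (full_shift A) :=
  [set x | forall w n, w \in W -> subword x n (size w) != w].

Lemma sft_shift (W : seq (seq A)) m x : sft W x -> sft W (shift m x).
Proof.
move=> Wx w n wW; rewrite (_ : subword _ _ _ = subword x (n + m) (size w)).
  exact: Wx.
by apply: eq_map => i; rewrite /shift addrAC.
Qed.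

End shifts.

Section suspension.
Context {R : realType} {A : finType} (W : seq (seq A)).

Definition sft_power (m : int) (x : sft W) : sft W :=
  exist _ (shift m (val x)) (mem_set (sft_shift m (set_valP x))).

Definition unit_itv : Type := set_type (`[0, 1]%classic : set R).

HB.instance Definition _ := Topological.on unit_itv.

Definition susp_domain : topologicalType := ((sft W : Type) * unit_itv)%type.

(* (x, 1) ~ (sigma x, 0) *)
Definition susp_glue (a b : susp_domain) : Prop :=
  [/\ val a.2 = 1, val b.2 = 0 & b.1 = sft_power 1 a.1].

Definition susp_equiv (a b : susp_domain) : bool :=
  `[< clos_refl_sym_trans susp_domain susp_glue a b >].

Lemma susp_equiv_refl : reflexive susp_equiv.
Proof. by move=> a; apply/asboolP; exact: rst_refl. Qed.

Lemma susp_equiv_sym : symmetric susp_equiv.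
Proof. by move=> a b; apply/idP/idP => /asboolP ab; apply/asboolP; exact: rst_sym. Qed.

Lemma susp_equiv_trans : transitive susp_equiv.
Proof.
by move=> b a c /asboolP ab /asboolP bc; apply/asboolP; exact: rst_trans bc.
Qed.

Canonical susp_equiv_equiv :=
  EquivRel susp_equiv susp_equiv_refl susp_equiv_sym susp_equiv_trans.

Local Open Scope quotient_scope.

Definition Susp : Type := quotient_topology {eq_quot susp_equiv}.

HB.instance Definition _ := Topological.on Susp.
HB.instance Definition _ := Quotient.on Susp.

Definition frac_part (u : R) : R := u - (Num.floor u)%:~R.

Lemma frac_part_itv (u : R) : `[0, 1]%classic (frac_part u).
Proof.
rewrite /= in_itv/= subr_ge0 Num.Theory.floor_le/=.
by rewrite lerBlDl -intrD1 ltW// Num.Theory.floorD1_gt.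
Qed.

(* phi_t (x, s) = (x, s + t), put back into [0, 1] by means of
   (x, r + m) ~ (sigma^m x, r). *)
Definition susp_domain_flow (t : R) (a : susp_domain) : susp_domain :=
  let u := val a.2 + t in
  (sft_power (Num.floor u) a.1, exist _ (frac_part u) (mem_set (frac_part_itv u))).

Definition susp_flow (t : R) (z : Susp) : Susp :=
  \pi_Susp (susp_domain_flow t (repr z)).

Lemma susp_flow_pi t (a : susp_domain) :
  susp_flow t (\pi_Susp a) = \pi_Susp (susp_domain_flow t a).
Proof.
have stable b c : clos_refl_sym_trans susp_domain susp_glue b c ->
    susp_domain_flow t b = susp_domain_flow t c.
  elim=> [{}b {}c [b1 c0 bc]|//|{}b {}c _ ->//|{}b d {}c _ -> _ ->//].
  have fl : Num.floor (val b.2 + t) = Num.floor (val c.2 + t) + 1.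
    by rewrite b1 c0 add0r (addrC 1 t) Num.Theory.floorDrz ?rpred1// Num.Theory.floor1.
  have fr : frac_part (val b.2 + t) = frac_part (val c.2 + t).
    by rewrite /frac_part fl b1 c0 intrD; lra.
  rewrite /susp_domain_flow; congr pair; apply: val_inj => //=.
  by rewrite fl bc/=; apply/funext => n; rewrite /shift/= addrA.
rewrite /susp_flow; congr (\pi_Susp _); apply: stable; apply/asboolP.
by apply/(@eqmodP _ susp_equiv_equiv); rewrite reprK.
Qed.

End suspension.

Arguments Susp R {A} W.
Arguments susp_flow R {A} W t z.

Section flows.
Context {R : realType}.

Definition orbit_of {Z : Type} (f : R -> Z -> Z) (z : Z) : set Z :=
  range (fun t => f t z).

(* An orbit carries its intrinsic topology and orientation, not the subspace
   topology: the charts around [z] are the maps [t |-> f t z] on small intervals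
   around 0.  In these charts [h] is [alpha], an increasing homeomorphism
   between open intervals; the injectivity ensures that [t |-> f t z] and
   [t |-> g t (h z)] are indeed charts. *)
Definition orbit_local_homeo {Z1 Z2 : Type} (f : R -> Z1 -> Z1)
    (g : R -> Z2 -> Z2) (h : Z1 -> Z2) (z : Z1) : Prop :=
  exists (e : R) (alpha : R -> R),
    [/\ 0 < e, alpha 0 = 0, {within `]-e, e[, continuous alpha},
        {in `]-e, e[ &, {homo alpha : s t / s < t}} &
        {in `]-e, e[, forall t, h (f t z) = g (alpha t) (h z)} /\
        {in `]-e, e[ &, injective (fun t => h (f t z))}].

Definition orbit_semi_equivalence {Z1 Z2 : topologicalType}
    (f : R -> Z1 -> Z1) (g : R -> Z2 -> Z2) (h : Z1 -> Z2) : Prop :=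
  [/\ continuous h, range h = setT &
      forall z, h @` orbit_of f z = orbit_of g (h z) /\
                orbit_local_homeo f g h z].

Definition topologically_transitive {Z : topologicalType} (f : R -> Z -> Z) :=
  forall U V : set Z, open U -> open V -> U !=set0 -> V !=set0 ->
    exists2 t, 0 <= t & (f t @` U) `&` V !=set0.

(* The finite collection is (x i, t i), 1 <= i <= k; the value of [tau] at 0
   is 0. *)
Definition weak_specification {Z : Type} (d : Z -> Z -> R) (f : R -> Z -> Z) :=
  forall delta : R, 0 < delta -> exists2 T : R, 0 < T &
    forall (k : nat) (x : nat -> Z) (t : nat -> R), (1 <= k)%N ->
      (forall i, (1 <= i <= k)%N -> 0 <= t i) ->
      exists (y : Z) (tau : nat -> R),
        let s j := \sum_(1 <= i < j.+1) t i + \sum_(1 <= i < j) tau i in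
        [/\ tau 0 = 0, forall i, (1 <= i < k)%N -> 0 <= tau i <= T &
            forall j, (1 <= j <= k)%N -> forall u, 0 <= u <= t j ->
              d (f u (f (s j.-1 + tau j.-1) y)) (f u (x j)) < delta].

End flows.

(* Main.v *)
Require Import Defs.
From Stdlib Require Import Relations.Relation_Operators.
From mathcomp Require Import all_boot all_order all_algebra generic_quotient.
From mathcomp Require Import all_classical all_reals all_analysis.
From mathcomp Require Import measurable_realfun.
From mathcomp Require Import lra ring zify.

(** The symbolic orbits determine the geodesics of [X] up to a time change, and
   two ingredients transport specification through it.  First, a subshift of
   finite type whose suspension maps onto a topologically transitive flow has a
   single communicating class whose suspension already maps onto it: otherwise
   some open set is missed by each class, and an orbit visiting these sets
   cyclically often enough would change class more often than there are classes.
   In one class, words can be concatenated with bounded connecting words.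
   Secondly, if the symbolic orbits of [y] and [x] agree, the corresponding
   geodesics stay close up to reparametrization; the nearest-point projection to
   a local geodesic being locally 1-Lipschitz in CAT(0) balls, the two times
   elapsed differ by a bounded multiple of the distance, whatever the length.
   So the geodesics are close with their own parametrizations. *)

Set Implicit Arguments.
Unset Strict Implicit.
Unset Printing Implicit Defensive.

Import Order.TTheory GRing.Theory Num.Theory.
Import numFieldNormedType.Exports.

Local Open Scope classical_set_scope.
Local Open Scope ring_scope.
Local Open Scope quotient_scope.

(** * Metric preliminaries *)

Section metric.
Context {R : realType} {X : metricType R}.
Implicit Types (x y z : X) (c : R -> X).

(** The obstacle is the length of the orbit segments. Two orbits that share a long word are close at
    every tick of a subdivision of suspension time, but adding up errors tick by tick would give a
    time lag proportional to the length, and the connecting times would not be bounded. Comparing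
    feet of perpendiculars instead of the times themselves leaves only the errors at the two ends.
    The CAT(0) inequality is local, at one scale [r] valid everywhere by compactness; the fractions
    [r / 8] and [r / 16] keep consecutive feet in a common CAT(0) set. The universal cover enters
    through the metric of [GX]: closeness for [dGX] is traded for uniform closeness in [X] on
    bounded time intervals. The time change is controlled from both sides: a unit of suspension time
    takes at most a fixed time of the geodesic flow, by uniform continuity, and at least a fixed
    positive time, by local injectivity, so that words can be made long enough for any prescribed
    time. *)

Lemma nbhs_mdist x (U : set X) :
  nbhs x U <-> exists2 e : R, 0 < e & forall y, mdist x y < e -> U y.
Proof.
split=> [/nbhs_ballP[e /= e0 eU]|[e e0 eU]].
  by exists e => // y xy; apply: eU; rewrite ballEmdist.
by apply/nbhs_ballP; exists e => //= y; rewrite ballEmdist => /eU.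
Qed.

(** [P] is left arbitrary: the number is wanted both for CAT(0) sets and for evenly covered sets. *)
Lemma lebesgue_number (P : set X -> Prop) : compact [set: X] ->
  (forall x, exists2 U, nbhs x U & P U) ->
  exists2 r : R, 0 < r &
    forall x, exists2 U, P U & forall y, mdist x y < r -> U y.
Proof.
move=> /compact_near_coveringP cX PX.
have : \forall r \near 0^'+, [set: X] `<=`
    [set x | exists2 U, P U & forall y, mdist x y < r -> U y].
  apply: cX => x _; have [U /nbhs_mdist[e e0 eU] PU] := PX x.
  exists (ball x (e / 2), [set r | r < e / 2]) => /=.
    split; first by apply: nbhsx_ballx; rewrite divr_gt0.
    by apply: nbhs_right_lt; rewrite divr_gt0.
  move=> [y r] /= [+ re]; rewrite ballEmdist /= => xy.
  exists U => // z yz; apply: eU; apply: le_lt_trans (metric_triangle _ y _) _.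
  by rewrite (splitr e) ltrD// (lt_trans yz).
move=> PXr; near (at_right (0 : R)) => r; exists r => // x.
by have := near PXr r; apply.
Unshelve. all: end_near. Qed.

(* Cousin's lemma: the property holds up to the supremum of the points it
   reaches from [a], hence beyond it. *)
Lemma cousin (P : R -> R -> Prop) (a b : R) : a <= b ->
  (forall u v w, a <= u -> u <= v -> v <= w -> w <= b ->
     P u v -> P v w -> P u w) ->
  (forall t, a <= t <= b -> exists2 e : R, 0 < e &
     forall u v, t - e < u -> u <= t -> t <= v -> v < t + e ->
       a <= u -> v <= b -> P u v) ->
  P a b.
Proof.
move=> ab Ptr Ploc; pose S := [set v | a <= v <= b /\ P a v].
have Sa : S a.
  have [|e e0 Pe] := Ploc a; first by rewrite lexx.
  by split; [rewrite lexx ab|apply: Pe; rewrite ?ltrDl ?ltrBlDr ?ltrDl ?lexx].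
have supS : has_sup S by split; [exists a|exists b => v [/andP[]]].
have as_ : a <= sup S by apply: ub_le_sup => //; case: supS.
have sb : sup S <= b by apply: ge_sup => [|v [/andP[]]//]; exists a.
have [|e e0 Pe] := Ploc (sup S); first by rewrite as_.
have [u [/andP[au ub] Pau] eu] := @sup_adherent _ S _ e0 supS.
have us : u <= sup S by apply: ub_le_sup => //; [case: supS|split=> //; rewrite au].
have ext v : sup S <= v -> v < sup S + e -> v <= b -> P a v.
  move=> sv ve vb; apply: (Ptr _ u) => //; first exact: le_trans sv.
  exact: Pe.
have [bs|sb'] := leP b (sup S); first by apply: ext => //; lra.
pose v := Num.min b (sup S + e / 2).
have sv : sup S < v by rewrite lt_min sb' ltrDl divr_gt0.
suff : v <= sup S by rewrite leNgt sv.
apply: ub_le_sup; first by case: supS.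
have vb : v <= b by rewrite ge_min lexx.
split; first by rewrite vb andbT (le_trans as_)// ltW.
apply: ext => //; first exact: ltW.
by rewrite gt_min ltrD2l ltr_pdivrMr// mulr_natr mulr2n ltrDl e0 orbT.
Qed.

(** Only the inequality globalizes, by the triangle inequality on consecutive pieces; a closed
    geodesic returns to its starting point. *)
Lemma locally_isometric_lipschitz c : locally_isometric c ->
  forall s t, mdist (c s) (c t) <= `|s - t|.
Proof.
move=> ic; suff le s t : s <= t -> mdist (c s) (c t) <= t - s.
  move=> s t; have [st|ts] := leP s t.
    by rewrite distrC ger0_norm ?subr_ge0//; exact: le.
  by rewrite metric_sym gtr0_norm ?subr_gt0//; exact/le/ltW.
move=> st; apply: (@cousin (fun u v => mdist (c u) (c v) <= v - u)) => //.
  move=> u v w _ _ _ _ uv vw; apply: le_trans (metric_triangle _ (c v) _) _.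
  by move: uv vw; lra.
move=> t0 _; have [e e0 ie] := ic t0; exists e => // u v eu ut tv ve _ _.
rewrite ie; first by rewrite distrC ger0_norm ?subr_ge0// (le_trans ut).
  by rewrite ler0_norm ?subr_le0//; lra.
by rewrite ger0_norm ?subr_ge0//; lra.
Qed.

End metric.

(** * CAT(0) inequalities *)

Section cat0.
Context {R : realType} {X : metricType R}.
Implicit Types (x y z : X) (c : R -> X).

Lemma euclid_distC (P Q : R * R) : euclid_dist P Q = euclid_dist Q P.
Proof.
by rewrite /euclid_dist -(sqrrN (P.1 - Q.1)) -(sqrrN (P.2 - Q.2)) !opprB.
Qed.

Lemma euclid_distE (P Q : R * R) (d : R) : 0 <= d ->
  (P.1 - Q.1) ^+ 2 + (P.2 - Q.2) ^+ 2 = d ^+ 2 -> euclid_dist P Q = d.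
Proof. by move=> d0 e; rewrite /euclid_dist e sqrtr_sqr ger0_norm. Qed.

(** In the comparison triangle Stewart's theorem is an equality. The factor [mdist x y] is not
    divided out, so that a degenerate side is allowed. *)
Lemma CAT0_stewart (U : set X) x y z c s : CAT0_set U -> U x -> U y -> U z ->
  geodesic_segment U x y c -> 0 <= s <= mdist x y ->
  mdist x y * mdist z (c s) ^+ 2 <=
    (mdist x y - s) * mdist z x ^+ 2 + s * mdist z y ^+ 2 -
    s * (mdist x y - s) * mdist x y.
Proof.
move=> [gU ineqU] Ux Uy Uz gc /andP[s0 sl].
have [l0|l0] := eqVneq (mdist x y) 0.
  have -> : s = 0 by apply/eqP; rewrite eq_le s0 -[X in _ <= X]l0 sl.
  by rewrite l0; lra.
have {}l0 : 0 < mdist x y by rewrite lt_neqAle eq_sym l0 mdist_ge0.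
have [c1 gc1] := gU y z Uy Uz; have [c2 gc2] := gU z x Uz Ux.
have tr1 := metric_triangle x z y; have tr2 := metric_triangle z x y.
have tr3 := metric_triangle z y x.
rewrite (metric_sym x z) in tr1; rewrite (metric_sym y x) in tr3.
have a0 := mdist_ge0 z x; have b0 := mdist_ge0 z y.
set l := mdist x y in l0 sl tr1 tr2 tr3 *; set a := mdist z x in a0 tr1 tr2 tr3 *.
set b := mdist z y in b0 tr1 tr2 tr3 *.
(* The third vertex is [(h, k)], with the abscissa [h] given by the law of cosines. *)
pose h := (l ^+ 2 + a ^+ 2 - b ^+ 2) / (2 * l).
have hE : 2 * l * h = l ^+ 2 + a ^+ 2 - b ^+ 2 by rewrite /h; field; lra.
(* Heron's factorization: the difference is a product of the three triangle inequalities and the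
   perimeter. *)
have ha : h ^+ 2 <= a ^+ 2.
  have l2 : 0 < (2 * l) ^+ 2 by rewrite exprn_gt0// mulr_gt0.
  rewrite -(ler_pM2l l2) -exprMn hE -subr_ge0.
  have -> : (2 * l) ^+ 2 * a ^+ 2 - (l ^+ 2 + a ^+ 2 - b ^+ 2) ^+ 2 =
    ((a + b - l) * (l + b - a)) * ((l + a - b) * (l + a + b)) by ring.
  by apply: mulr_ge0; apply: mulr_ge0; lra.
pose k := Num.sqrt (a ^+ 2 - h ^+ 2).
have kE : k ^+ 2 = a ^+ 2 - h ^+ 2 by rewrite sqr_sqrtr// subr_ge0.
pose v (i : 'I_3) := nth x [:: x; y; z] i.
pose cc (i : 'I_3) := nth c [:: c; c1; c2] i.
pose w (i : 'I_3) : R * R := nth (0, 0) [:: (0, 0); (l, 0); (h, k)] i.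
have w01 : euclid_dist (0, 0) (l, 0) = l by apply: euclid_distE => /=; [lra|ring].
have w02 : euclid_dist (0, 0) (h, k) = a.
  by apply: euclid_distE => //=; rewrite !sub0r !sqrrN kE; ring.
have w12 : euclid_dist (l, 0) (h, k) = b.
  apply: euclid_distE => //=; rewrite sub0r sqrrN kE.
  by transitivity (l ^+ 2 - 2 * l * h + a ^+ 2); [ring|rewrite hE; ring].
have ww (P : R * R) : euclid_dist P P = 0.
  by apply: euclid_distE => //; rewrite !subrr; ring.
have Hv i : U (v i) by case: i => [[|[|[|//]]] lti].
have Hc i : geodesic_segment U (v i) (v (ordS i)) (cc i).
  by case: i => [[|[|[|//]]] lti].
have Hw i j : euclid_dist (w i) (w j) = mdist (v i) (v j).
  case: i => [[|[|[|//]]] lti]; case: j => [[|[|[|//]]] ltj];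
    rewrite /w /v /= ?ww ?mdistxx ?w01 ?w02 ?w12 //;
    by rewrite 1?[euclid_dist _ _]euclid_distC ?w01 ?w02 ?w12 // /l /a /b metric_sym.
(* The vertex [z] is taken as the initial point of side 2, to be compared with a point of side 0. *)
pose i0 : 'I_3 := @Ordinal 3 0 isT; pose i2 : 'I_3 := @Ordinal 3 2 isT.
have := ineqU v cc w Hv Hc Hw i0 i2 s 0 (s, 0) (h, k).
have c20 : c2 0 = z by case: gc2.
rewrite /v /cc /= c20 !in_itv /= s0 sl lexx a0 => /(_ isT isT).
have cP : comparison_point v w i0 s (s, 0).
  by split; apply: euclid_distE => //=; rewrite /v /= -/l ?subr_ge0//; ring.
have cQ : comparison_point v w i2 0 (h, k).
  by split; rewrite /w /v /= ?ww// euclid_distC w02 subr0.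
move=> /(_ cP cQ) {cP cQ}.
rewrite -(@ler_pXn2r _ 2)// ?nnegrE ?mdist_ge0 ?sqrtr_ge0//.
rewrite metric_sym sqr_sqrtr ?addr_ge0 ?sqr_ge0// => /= le_zc.
rewrite -(ler_pM2l l0) in le_zc; apply: le_trans le_zc _.
have -> : (s - h) ^+ 2 + (0 - k) ^+ 2 = s ^+ 2 - 2 * s * h + a ^+ 2.
  by rewrite sub0r sqrrN kE; ring.
have -> : l * (s ^+ 2 - 2 * s * h + a ^+ 2) =
  l * s ^+ 2 - s * (2 * l * h) + l * a ^+ 2 by ring.
by rewrite hE le_eqVlt; apply/orP; left; apply/eqP; ring.
Qed.


(** Stewart's inequality at the midpoint of one diagonal bounds its distances [p], [q] to the ends
    of the other, and [(p + q) ^+ 2 <= 2 * p ^+ 2 + 2 * q ^+ 2] recombines them. *)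
Lemma CAT0_quadrilateral (U : set X) (x y z t : X) : CAT0_set U ->
  U x -> U y -> U z -> U t ->
  mdist x z ^+ 2 + mdist y t ^+ 2 <=
    mdist x y ^+ 2 + mdist y z ^+ 2 + mdist z t ^+ 2 + mdist t x ^+ 2.
Proof.
move=> catU Ux Uy Uz Ut; have [c gc] := catU.1 y t Uy Ut.
have l0 := mdist_ge0 y t; set l := mdist y t in l0 *.
have [l00|l1] := eqVneq l 0.
  have yt : y = t by exact: mdist_positivity.
  rewrite l00 -yt (metric_sym z y) (metric_sym y x).
  have := metric_triangle x y z; have := mdist_ge0 x y; have := mdist_ge0 y z.
  have := mdist_ge0 x z.
  set a := mdist x z; set b := mdist x y; set d := mdist y z => a0 d0 b0 abd.
  rewrite expr0n /= addr0; apply: (@le_trans _ _ ((b + d) ^+ 2)).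
    by rewrite ler_pXn2r ?nnegrE ?addr_ge0.
  have := sqr_ge0 (b - d); rewrite -subr_ge0 => bd.
  by rewrite -subr_ge0; apply: le_trans bd _; rewrite le_eqVlt; apply/orP; left; apply/eqP; ring.
have {l1}l1 : 0 < l by rewrite lt_neqAle eq_sym l1.
have sl : 0 <= l / 2 <= l by apply/andP; split; lra.
have := @CAT0_stewart U y t x c (l / 2) catU Uy Ut Ux gc sl.
have := @CAT0_stewart U y t z c (l / 2) catU Uy Ut Uz gc sl.
have := metric_triangle x (c (l / 2)) z; have := mdist_ge0 x z.
rewrite (metric_sym (c _) z) (metric_sym t x) (metric_sym y z) -/l.
set m := c _; set p := mdist x m; set q := mdist z m; set a := mdist x z.
set xy := mdist x y; set xt := mdist x t; set zy := mdist z y; set zt := mdist z t.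
move=> a0 apq stz stx.
have a2 : a ^+ 2 <= 2 * p ^+ 2 + 2 * q ^+ 2.
  apply: (@le_trans _ _ ((p + q) ^+ 2)).
    by rewrite ler_pXn2r ?nnegrE ?addr_ge0 ?mdist_ge0.
  rewrite -subr_ge0; have := sqr_ge0 (p - q).
  by congr (0 <= _); ring.
have st k (u v w : R) : k = l / 2 -> l * u <= (l - k) * v + k * w - k * (l - k) * l ->
    2 * u <= v + w - l ^+ 2 / 2.
  move=> -> h; rewrite -(ler_pM2l l1).
  have : 2 * (l * u) <= 2 * ((l - l / 2) * v + l / 2 * w - l / 2 * (l - l / 2) * l).
    by rewrite ler_pM2l.
  have -> : 2 * ((l - l / 2) * v + l / 2 * w - l / 2 * (l - l / 2) * l) =
    l * (v + w - l ^+ 2 / 2) by field.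
  by rewrite mulrCA.
by move: (st _ _ _ _ erefl stx) (st _ _ _ _ erefl stz) a2; lra.
Qed.

Lemma locally_isometric_segment (U : set X) c a b : locally_isometric c ->
  a <= b -> (forall t, a <= t <= b -> U (c t)) ->
  (forall s t, a <= s <= b -> a <= t <= b -> mdist (c s) (c t) = `|s - t|) ->
  geodesic_segment U (c a) (c b) (fun t => c (a + t)).
Proof.
move=> ic ab Uc isoc; have dab : mdist (c a) (c b) = b - a.
  by rewrite isoc ?lexx ?ab// distrC ger0_norm// subr_ge0.
split; rewrite ?addr0// dab ?subrKC//.
  by move=> t; rewrite in_itv/= => /andP[t0 tb]; apply: Uc; apply/andP; split; lra.
move=> s t; rewrite !in_itv/= => /andP[s0 sb] /andP[t0 tb].
by rewrite isoc; [congr `|_|; ring|apply/andP; split; lra..].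
Qed.

(* If [c] is geodesic from [a] to [u], Stewart's inequality at [c u] in a thin
   triangle with apex [c a] shows that it remains so a little beyond [u]. *)
Lemma CAT0_local_geodesic (U : set X) c a b : CAT0_set U ->
  locally_isometric c -> a <= b -> (forall t, a <= t <= b -> U (c t)) ->
  mdist (c a) (c b) = b - a.
Proof.
move=> catU ic ab Uc; pose G v := forall s, a <= s <= v -> mdist (c a) (c s) = s - a.
have Ga : G a.
  move=> s; rewrite andbC => /le_anti <-.
  by rewrite subrr mdistxx.
suff : G b by apply; rewrite ab lexx.
move: Ga; apply: (@cousin _ (fun u v => G u -> G v)) => //.
  by move=> u v w _ _ _ _ uv vw /uv.
move=> t tab; have [e e0 ie] := ic t; exists e => // u v eu ut tv ve au vb Gu s.
move=> /andP[as_ sv]; have [su|us] := leP s u; first by apply: Gu; rewrite as_.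
have isoc s1 s2 : t - e < s1 -> s1 <= v -> t - e < s2 -> s2 <= v ->
    mdist (c s1) (c s2) = `|s1 - s2|.
  by move=> ? ? ? ?; apply: ie; rewrite ltr_norml; apply/andP; split; lra.
move: au; rewrite le_eqVlt => /predU1P[au|au].
  by rewrite isoc; [rewrite distrC ger0_norm; lra|lra..].
(* The base of the thin triangle starts [n] before [u]: after [a], and inside the window where [c]
   is isometric. *)
pose n := Num.min (u - a) ((u - (t - e)) / 2).
have n0 : 0 < n by rewrite lt_min subr_gt0 au divr_gt0// subr_gt0.
have na : n <= u - a by rewrite ge_min lexx.
have nt : n <= (u - (t - e)) / 2 by rewrite ge_min lexx orbT.
have au' : a <= u - n by lra.
have gc : geodesic_segment U (c (u - n)) (c s) (fun t => c (u - n + t)).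
  apply: locally_isometric_segment => //; first lra.
    by move=> w /andP[? ?]; apply: Uc; apply/andP; split; lra.
  by move=> s1 s2 /andP[? ?] /andP[? ?]; apply: isoc; lra.
have ds : mdist (c (u - n)) (c s) = s - u + n.
  by rewrite isoc; [rewrite distrC ger0_norm; lra|lra..].
have := @CAT0_stewart U _ _ (c a) _ n catU _ _ _ gc.
rewrite ds subrK (Gu u) ?lexx ?(ltW au)// (Gu (u - n)); last first.
  by apply/andP; split; lra.
have U1 : U (c (u - n)) by apply: Uc; apply/andP; split; lra.
have U2 : U (c s) by apply: Uc; apply/andP; split; lra.
have U3 : U (c a) by apply: Uc; apply/andP; split; lra.
move=> /(_ U1 U2 U3) {U1 U2 U3}; set f := mdist _ _.
have -> : (0 <= n <= s - u + n) = true by apply/andP; split; lra.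
move=> /(_ isT) st; apply/eqP; rewrite eq_le; apply/andP; split.
  rewrite (le_trans (locally_isometric_lipschitz ic _ _))//.
  by rewrite distrC ger0_norm// subr_ge0.
rewrite -(@ler_pXn2r _ 2)// ?nnegrE ?mdist_ge0 ?subr_ge0//.
rewrite -(ler_pM2l n0) -subr_ge0; move: st; rewrite -subr_ge0.
by congr (0 <= _); ring.
Qed.

End cat0.

(** * Nearest-point projection to a local geodesic *)

Section drift.
Context {R : realType} {X : metricType R}.
Implicit Types (x y z : X) (c : R -> X).

Lemma lipschitz_continuous (k : R) (f : R -> R) :
  (forall s t, `|f s - f t| <= k * `|s - t|) -> continuous f.
Proof.
move=> lf t; apply/cvgrPdist_lt => e e0; have k0 : 0 <= k.
  by have := lf 1 0; rewrite subr0 normr1 mulr1; apply: le_trans.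
near=> s; apply: le_lt_trans (lf t s) _.
apply: (@le_lt_trans _ _ ((k + 1) * `|t - s|)); first by rewrite ler_wpM2r// lerDl.
rewrite mulrC -ltr_pdivlMr ?ltr_wpDl//; near: s.
apply: cvgr_dist_lt => //; apply: divr_gt0 => //; exact: ltr_wpDl.
Unshelve. all: end_near. Qed.

Lemma mdist_lipschitz x y x' y' :
  `|mdist x y - mdist x' y'| <= mdist x x' + mdist y y'.
Proof.
have := metric_triangle x x' y; have := metric_triangle x' y' y.
have := metric_triangle x' x y'; have := metric_triangle x y y'.
rewrite (metric_sym x' x) (metric_sym y' y) ler_norml => h1 h2 h3 h4.
by apply/andP; split; lra.
Qed.

Lemma continuous_mdist_line z c : locally_isometric c ->
  continuous (fun t => mdist z (c t)).
Proof.
move=> ic; apply: (@lipschitz_continuous 1) => s t.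
apply: le_trans (mdist_lipschitz _ _ _ _) _.
by rewrite mdistxx add0r mul1r; exact: locally_isometric_lipschitz.
Qed.

(** The angle at a nearest point is at least right. Stewart's inequality at distance [s] from the
    foot, divided by [s], gives the bound up to an error [s * l], and [s] is arbitrarily small. *)
Lemma sqr_dist_foot (U : set X) c (pi u : R) z : CAT0_set U ->
  U (c pi) -> U (c u) -> U z ->
  (exists g, geodesic_segment U (c pi) (c u) g /\
     forall s, 0 <= s <= mdist (c pi) (c u) -> mdist z (c pi) <= mdist z (g s)) ->
  mdist z (c pi) ^+ 2 + mdist (c pi) (c u) ^+ 2 <= mdist z (c u) ^+ 2.
Proof.
move=> catU U1 U2 Uz [g [gc mg]]; set l := mdist (c pi) (c u) in mg *.
have [l0|l0] := eqVneq l 0.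
  by rewrite (mdist_positivity _ _ l0) l0 expr0n addr0.
have {}l0 : 0 < l by rewrite lt_neqAle eq_sym l0 mdist_ge0.
apply/ler_addgt0Pr => e e0; pose s := Num.min l (e / l).
have s0 : 0 < s by rewrite lt_min l0 divr_gt0.
have sl : s <= l by rewrite ge_min lexx.
have se : s * l <= e by rewrite -ler_pdivlMr// ge_min lexx orbT.
have s0l : 0 <= s <= l by rewrite ltW.
have := @CAT0_stewart _ _ U _ _ z g s catU U1 U2 Uz gc s0l; rewrite -/l => st.
have f2 : mdist z (c pi) ^+ 2 <= mdist z (g s) ^+ 2.
  by rewrite ler_pXn2r ?nnegrE ?mdist_ge0// mg.
set f := mdist z (c pi) ^+ 2 in st f2 *; set g2 := mdist z (c u) ^+ 2 in st *.
have {}f2 : l * f <= l * mdist z (g s) ^+ 2 by rewrite ler_pM2l.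
have : s * f <= s * (g2 - (l - s) * l).
  rewrite -subr_ge0; move: (le_trans f2 st); rewrite -subr_ge0.
  by congr (0 <= _); ring.
by rewrite ler_pM2l//; move: se; rewrite mulrBl expr2; lra.
Qed.

(** The right-angle inequalities at the two feet, added to the inequality of the quadrilateral [x],
    [x'], [c pi'], [c pi], leave [(pi' - pi) ^+ 2 <= mdist x x' ^+ 2]. *)
Lemma foot_lipschitz (U : set X) c (a b pi pi' : R) x x' : CAT0_set U ->
  locally_isometric c -> (forall t, a <= t <= b -> U (c t)) -> U x -> U x' ->
  a <= pi <= b -> a <= pi' <= b ->
  (forall t, a <= t <= b -> mdist x (c pi) <= mdist x (c t)) ->
  (forall t, a <= t <= b -> mdist x' (c pi') <= mdist x' (c t)) ->
  pi' - pi <= mdist x x'.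
Proof.
move=> catU ic Uc Ux Ux' /andP[api pib] /andP[api' pi'b] mpi mpi'.
have [le|lt] := leP pi' pi.
  by apply: le_trans (mdist_ge0 _ _); rewrite subr_le0.
have isoc s t : pi <= s <= pi' -> pi <= t <= pi' -> mdist (c s) (c t) = `|s - t|.
  wlog st : s t / s <= t => [wl|].
    have [/wl//|/ltW ts] := leP s t.
    by move=> sp tp; rewrite metric_sym distrC wl.
  move=> /andP[? ?] /andP[? ?]; rewrite (@CAT0_local_geodesic _ _ U)//.
    by rewrite distrC ger0_norm// subr_ge0.
  by move=> w /andP[? ?]; apply: Uc; apply/andP; split; lra.
have dpi : mdist (c pi) (c pi') = pi' - pi.
  by rewrite isoc ?lexx ?(ltW lt)// distrC ger0_norm// subr_ge0 ltW.
have gc : geodesic_segment U (c pi) (c pi') (fun t => c (pi + t)).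
  apply: locally_isometric_segment => //; first exact: ltW.
  by move=> w /andP[? ?]; apply: Uc; apply/andP; split; lra.
have gc' : geodesic_segment U (c pi') (c pi) (fun t => c (pi' - t)).
  have [? ? Ug ig] := gc; rewrite /geodesic_segment metric_sym dpi.
  split; rewrite ?subr0 ?subKr// => s; last move=> t.
    by rewrite in_itv/= => /andP[? ?]; apply: Uc; apply/andP; split; lra.
  rewrite !in_itv/= => /andP[? ?] /andP[? ?]; rewrite isoc; last 2 first.
  - by apply/andP; split; lra.
  - by apply/andP; split; lra.
  by rewrite distrC; congr `|_|; ring.
have U1 : U (c pi) by apply: Uc; rewrite api pib.
have U2 : U (c pi') by apply: Uc; rewrite api' pi'b.
have := @sqr_dist_foot U c pi pi' x catU U1 U2 Ux.
have := @sqr_dist_foot U c pi' pi x' catU U2 U1 Ux'.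
rewrite (metric_sym (c pi') (c pi)) dpi => f2 f1.
have {}f1 : mdist x (c pi) ^+ 2 + (pi' - pi) ^+ 2 <= mdist x (c pi') ^+ 2.
  apply: f1; exists (fun t => c (pi + t)); split=> // s /andP[? ?].
  by apply: mpi; apply/andP; split; lra.
have {}f2 : mdist x' (c pi') ^+ 2 + (pi' - pi) ^+ 2 <= mdist x' (c pi) ^+ 2.
  apply: f2; exists (fun t => c (pi' - t)); split=> // s /andP[? ?].
  by apply: mpi'; apply/andP; split; lra.
have := @CAT0_quadrilateral _ _ U x x' (c pi') (c pi) catU Ux Ux' U2 U1.
rewrite (metric_sym (c pi') (c pi)) dpi (metric_sym (c pi) x) => q.
rewrite -(@ler_pXn2r _ 2) ?nnegrE ?mdist_ge0//; last by rewrite subr_ge0 ltW.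
by move: f1 f2 q; lra.
Qed.

Definition CAT0_radius (r : R) :=
  0 < r /\ forall x, exists2 U, CAT0_set U & forall y, mdist x y < r -> U y.

Lemma exists_CAT0_radius : compact [set: X] -> locally_CAT0 X ->
  exists r, CAT0_radius r.
Proof.
by move=> cX lX; have [r r0 rP] := lebesgue_number cX lX; exists r.
Qed.

(** A piece shorter than [r] stays in the ball about its start, hence in one CAT(0) set. The scale
    no longer depends on the line or on the point. *)
Lemma CAT0_radius_isometric (r : R) c s t : CAT0_radius r -> locally_isometric c ->
  `|s - t| < r -> mdist (c s) (c t) = `|s - t|.
Proof.
move=> [r0 rP] ic; wlog st : s t / s <= t => [wl|].
  have [/wl//|/ltW ts] := leP s t.
  by rewrite distrC => /wl; rewrite metric_sym => ->.
have [U catU Ur] := rP (c s); rewrite distrC ger0_norm ?subr_ge0// => str.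
apply: (CAT0_local_geodesic catU) => // w /andP[sw wt]; apply: Ur.
apply: le_lt_trans (locally_isometric_lipschitz ic _ _) _.
by rewrite distrC ger0_norm ?subr_ge0//; lra.
Qed.

(* The foot of [x (b j)] on [y] near [a j] stays within [2 e] of [a j], and
   moves by at most [b j.+1 - b j] at each step: distances can accumulate no
   error in this way. *)
Lemma CAT0_drift (r e : R) (y x : R -> X) (a b : nat -> R) (n : nat) :
  CAT0_radius r -> locally_isometric y -> locally_isometric x ->
  0 < e -> e <= r / 16 ->
  (forall j, (j <= n)%N -> mdist (x (b j)) (y (a j)) <= e) ->
  (forall j, (j < n)%N -> 0 <= a j.+1 - a j <= r / 8) ->
  (forall j, (j < n)%N -> 0 <= b j.+1 - b j <= r / 8) ->
  a n - a 0%N <= b n - b 0%N + 4 * e.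
Proof.
move=> rP iy ix e0 er clo sa sb; have [r0 rU] := rP.
pose foot j (pi : R) := `|pi - a j| <= 2 * e /\
  forall t, `|t - a j| <= r / 4 -> mdist (x (b j)) (y pi) <= mdist (x (b j)) (y t).
have ex_foot j : (j <= n)%N -> exists pi, foot j pi.
  move=> jn; pose l := a j - r / 4; pose u := a j + r / 4.
  have lu : l <= u by rewrite /l /u; lra.
  have cf : {within `[l, u], continuous (fun t => mdist (x (b j)) (y t))}.
    by apply: continuous_subspaceT; exact: continuous_mdist_line.
  have [pi] := EVT_min lu cf; rewrite in_itv/= => /andP[lpi piu] mpi; exists pi.
  have mpi' t : `|t - a j| <= r / 4 -> mdist (x (b j)) (y pi) <= mdist (x (b j)) (y t).
    by rewrite ler_norml => /andP[? ?]; apply: mpi; rewrite in_itv/=; apply/andP; split;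
      rewrite /l /u; lra.
  split=> //; rewrite -(@CAT0_radius_isometric r y)//; last first.
    by rewrite ltr_norml; apply/andP; split; move: lpi piu; rewrite /l /u; lra.
  apply: le_trans (metric_triangle _ (x (b j)) _) _.
  rewrite (metric_sym (y pi)); have := clo j jn.
  have := mpi' (a j); rewrite subrr normr0 => /(_ (ltW _)) h1 h2.
  by have := h1 ltac:(lra); move: h2; lra.
have [f0 foot0] := ex_foot 0%N isT.
(* The constant [4 * e] is made of [2 * e] at each end. *)
suff : exists2 pi, foot n pi & pi - f0 <= b n - b 0%N.
  move=> [pi [+ _]]; case: foot0 => + _; rewrite !ler_norml.
  by move=> /andP[? ?] /andP[? ?]; lra.
have : (n <= n)%N by []; elim: {-2}n => [_|j IH jn]; first by exists f0; rewrite ?subrr.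
have [pi fpi pi0] := IH (ltnW jn); have [pi' fpi'] := ex_foot _ jn.
exists pi' => //; suff : pi' - pi <= b j.+1 - b j by lra.
case: fpi fpi' => + mpi [+ mpi']; rewrite !ler_norml => /andP[p1 p2] /andP[p3 p4].
have /andP[sa1 sa2] := sa _ jn; have /andP[sb1 sb2] := sb _ jn.
have [U catU Ur] := rU (y (a j)).
apply: le_trans (_ : mdist (x (b j)) (x (b j.+1)) <= _); last first.
  by rewrite (le_trans (locally_isometric_lipschitz ix _ _))// distrC ger0_norm.
have lmin : Num.min pi pi' <= Num.max pi pi' by rewrite ge_min !le_max lexx.
(* A foot is within [r / 8] of its own time and consecutive times differ by at most [r / 8], so both
   feet lie in both windows of radius [r / 4] and minimize over the interval between them. *)
have mM t : Num.min pi pi' <= t <= Num.max pi pi' ->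
    a j - r / 4 <= t <= a j + r / 4 /\ a j.+1 - r / 4 <= t <= a j.+1 + r / 4.
  rewrite ge_min le_max => /andP[/orP h1 /orP h2].
  by split; apply/andP; split; case: h1; case: h2; lra.
apply: (@foot_lipschitz U y (Num.min pi pi') (Num.max pi pi')) => //.
- move=> t /mM[/andP[? ?] _]; apply: Ur.
  apply: le_lt_trans (locally_isometric_lipschitz iy _ _) _.
  by rewrite ltr_norml; apply/andP; split; lra.
- apply: Ur; rewrite metric_sym; have := clo j (ltnW jn); lra.
- apply: Ur; apply: le_lt_trans (metric_triangle _ (y (a j.+1)) _) _.
  have := locally_isometric_lipschitz iy (a j) (a j.+1).
  rewrite distrC ger0_norm// (metric_sym _ (x _)); have := clo _ jn; lra.
- by rewrite ge_min le_max lexx.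
- by rewrite ge_min le_max lexx !orbT.
- move=> t /mM[/andP[? ?] _]; apply: mpi.
  by rewrite ler_norml; apply/andP; split; lra.
- move=> t /mM[_ /andP[? ?]]; apply: mpi'.
  by rewrite ler_norml; apply/andP; split; lra.
Qed.

End drift.

Arguments CAT0_radius {R} X r.

(** * The universal cover *)

Lemma lipschitz_within {R : realType} {Y : metricType R} (k : R) (A : set R)
    (f : R -> Y) : 0 <= k ->
  (forall s t, A s -> A t -> mdist (f s) (f t) <= k * `|s - t|) ->
  {within A, continuous f}.
Proof.
move=> k0 lf; apply/subspace_continuousP => t At U /nbhs_mdist[e e0 eU].
rewrite /= !nbhs_filterE /within /=; near=> s => As; apply: eU.
apply: le_lt_trans (lf _ _ At As) _.
apply: (@le_lt_trans _ _ ((k + 1) * `|t - s|)); first by rewrite ler_wpM2r// lerDl.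
rewrite mulrC -ltr_pdivlMr ?ltr_wpDl//; near: s.
by apply: cvgr_dist_lt => //; apply: divr_gt0 => //; exact: ltr_wpDl.
Unshelve. all: end_near. Qed.

Lemma lipschitz1_continuous {R : realType} {Y : metricType R} (f : R -> Y) :
  (forall s t, mdist (f s) (f t) <= `|s - t|) -> continuous f.
Proof.
move=> lf t; have /subspace_continuousP : {within setT, continuous f}.
  by apply: (@lipschitz_within _ _ 1) => // s u _ _; rewrite mul1r.
by move=> /(_ t I); rewrite withinET.
Qed.

Section cover.
Context {R : realType} {Xt X : metricType R} {p : Xt -> X}.
Hypothesis p_cover : universal_cover p.

Let mdist_inf (a b : Xt) : (mdist a b)%:E =
  ereal_inf [set curve_length 0 1 (p \o c) | c in [set c | is_path c a b]].
Proof. by case: p_cover. Qed.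

Lemma curve_length_ge (c : R -> X) (t : R) : 0 <= t <= 1 ->
  ((mdist (c 0) (c t))%:E <= curve_length 0 1 c)%E.
Proof.
move=> /andP[t0 t1].
suff part s : itv_partition 0 1 s ->
    mdist (c 0) (c t) <= \sum_(0 <= n < size s)
      mdist ((c \o nth 1 (0 :: s)) n) ((c \o nth 1 (0 :: s)) n.+1) ->
    ((mdist (c 0) (c t))%:E <= curve_length 0 1 c)%E.
  have [t00|t0'] := eqVneq t 0.
    apply: (part [:: 1]); first exact: itv_partition1.
    by rewrite t00 mdistxx sumr_ge0// => *; rewrite mdist_ge0.
  have {t0'}t0 : 0 < t by rewrite lt_neqAle eq_sym t0'.
  have [t1'|t1'] := eqVneq t 1.
    apply: (part [:: 1]); first exact: itv_partition1.
    by rewrite /= big_nat1 /= t1'.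
  apply: (part [:: t; 1]); last by rewrite /= big_ltn// big_nat1 lerDl mdist_ge0.
  by split => //=; rewrite t0 lt_neqAle t1' t1.
move=> ps le; apply: (@le_trans _ _ (\sum_(0 <= n < size s)
      mdist ((c \o nth 1 (0 :: s)) n) ((c \o nth 1 (0 :: s)) n.+1))%:E).
  by rewrite lee_fin.
by apply: ereal_sup_ubound; exists s.
Qed.

Lemma curve_length_le (c : R -> X) (k : R) : 0 <= k ->
  (forall s t, 0 <= s <= 1 -> 0 <= t <= 1 -> mdist (c s) (c t) <= k * `|s - t|) ->
  (curve_length 0 1 c <= k%:E)%E.
Proof.
move=> k0 lc; apply: ge_ereal_sup => _ [s [ps /eqP ls] <-]; rewrite lee_fin.
suff gen a : 0 <= a -> path <%R a s -> last a s <= 1 -> a <= last a s /\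
    \sum_(0 <= n < size s) mdist ((c \o nth 1 (a :: s)) n) ((c \o nth 1 (a :: s)) n.+1)
      <= k * (last a s - a).
  have [|_] := gen 0 (lexx _) ps; first by rewrite ls.
  by rewrite ls subr0 mulr1.
elim: s a {ps ls} => [|x s IH] a a0 /=; first by rewrite big_geq// subrr mulr0.
move=> /andP[ax ps] ls; have x0 : 0 <= x by rewrite (le_trans a0)// ltW.
have [xs le] := IH x x0 ps ls; split; first by rewrite (le_trans (ltW ax)).
rewrite big_nat_recl//=; apply: (@le_trans _ _ (k * (x - a) + k * (last x s - x))).
  apply: lerD => //; rewrite -[X in _ <= k * X]ger0_norm ?subr_ge0; last exact: ltW.
  by rewrite distrC; apply: lc; rewrite ?a0 ?x0/=; lra.
by rewrite -mulrDr; apply: ler_wpM2l => //; lra.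
Qed.

Lemma mdist_cover_le a b : mdist (p a) (p b) <= mdist a b.
Proof.
rewrite -lee_fin mdist_inf; apply: le_ereal_inf_tmp => _ [c [_ c0 c1] <-].
by rewrite -c0 -c1; apply: (@curve_length_ge (p \o c)); rewrite ler01 lexx.
Qed.

Lemma mdist_path_le (c : R -> Xt) (k : R) : 0 <= k ->
  {within `[0, 1], continuous c} ->
  (forall s t, 0 <= s <= 1 -> 0 <= t <= 1 ->
     mdist (p (c s)) (p (c t)) <= k * `|s - t|) ->
  mdist (c 0) (c 1) <= k.
Proof.
move=> k0 cc lc; rewrite -lee_fin mdist_inf.
apply: le_trans (curve_length_le (c := p \o c) k0 lc).
by apply: ereal_inf_lbound; exists c.
Qed.

Lemma sheet_lift_continuous (U : set X) (V : set Xt) (A : set R) (f : R -> X)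
    (g : R -> Xt) : open V -> set_inj V p ->
  (forall W, open W -> W `<=` V -> open (p @` W)) ->
  {within A, continuous f} -> (forall t, A t -> V (g t) /\ p (g t) = f t) ->
  {within A, continuous g}.
Proof.
move=> oV injV pV /subspace_continuousP cf gV; apply/subspace_continuousP => t At W.
rewrite /= !nbhs_filterE => ntW; pose W' := W^° `&` V.
have [Vgt pgt] := gV t At.
have oW' : open W' by apply: openI => //; exact: open_interior.
have : nbhs (f t) (p @` W').
  apply: open_nbhs_nbhs; split; first exact: (pV W' oW' (@subIsetr _ _ _)).
  by exists (g t).
move=> /(cf t At) cfW; have : nbhs t [set s | A s -> (p @` W') (f s)] by exact: cfW.
apply: (@filterS _ _ (nbhs_filter t)) => s /= fs As.
have [b [Wb Vb] pb] := fs As; have [Vgs pgs] := gV s As.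
have bg : b = g s by apply: injV; rewrite ?inE// pgs.
by have : W (g s) by rewrite -bg; exact: interior_subset Wb.
Qed.

Definition isometric_section (rho : R) (a : Xt) (s : X -> Xt) :=
  s (p a) = a /\ forall y y', mdist (p a) y < rho -> mdist (p a) y' < rho ->
    p (s y) = y /\ mdist (s y) (s y') = mdist y y'.

Lemma exists_isometric_section : compact [set: X] -> geodesic_space X ->
  exists2 rho : R, 0 < rho & forall a, exists s, isometric_section rho a s.
Proof.
move=> cX gX; have [[_ _ ev] _ _] := p_cover.
have [x|r r0 rP] := @lebesgue_number _ X (evenly_covered p) cX.
  by have [U [oU Ux eU]] := ev x; exists U => //; exact: open_nbhs_nbhs.
(* Two points of the ball of radius [r / 3] are less than [2 * (r / 3)] apart, so a geodesic between
   them stays in the ball of radius [r], over which the sheet lifts it without increasing its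
   length. *)
exists (r / 3) => [|a]; first by rewrite divr_gt0.
have [U [S [pU _ SP]] Ur] := rP (p a).
have Upa : U (p a) by apply: Ur; rewrite mdistxx.
have : (p @^-1` U) a by []; rewrite pU => -[V SV Va].
have [oV injV imV pV] := SP _ SV.
have /choice[s sP] : forall y, exists b, U y -> V b /\ p b = y.
  move=> y; have [Uy|] := pselect (U y); last by exists a.
  by move: Uy; rewrite -imV => -[b Vb <-]; exists b.
have spa : s (p a) = a by have [? ?] := sP _ Upa; apply: injV; rewrite ?inE.
have Ur3 y : mdist (p a) y < r / 3 -> U y by move=> h; apply: Ur; lra.
exists s; split=> // y y' ry ry'; have [Vsy psy] := sP y (Ur3 _ ry).
have [Vsy' psy'] := sP y' (Ur3 _ ry'); split=> //; apply/eqP; rewrite eq_le.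
apply/andP; split; last by rewrite -{1}psy -{1}psy' mdist_cover_le.
have [c [c0 c1 _ ic]] := gX y y' I I; set d := mdist y y' in c1 ic *.
have d0 : 0 <= d by exact: mdist_ge0.
have dr : d < 2 * (r / 3).
  by have := metric_triangle y (p a) y'; rewrite (metric_sym y (p a)) -/d; lra.
have in01 t : 0 <= t <= 1 -> t * d \in `[0, d].
  by move=> /andP[t0 t1]; rewrite in_itv/= mulr_ge0//= ler_piMl.
have Uc t : 0 <= t <= 1 -> U (c (t * d)).
  move=> t01; apply: Ur; apply: le_lt_trans (metric_triangle _ y _) _.
  rewrite -c0 ic ?in01 ?in_itv/= ?lexx// sub0r normrN ger0_norm ?mulr_ge0//; last first.
    by case/andP: t01.
  by rewrite c0; have := in01 _ t01; rewrite in_itv/= => /andP[_]; lra.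
have lc u v : 0 <= u <= 1 -> 0 <= v <= 1 ->
    mdist (c (u * d)) (c (v * d)) <= d * `|u - v|.
  by move=> u01 v01; rewrite ic ?in01// -mulrBl normrM (ger0_norm d0) mulrC.
have := @mdist_path_le (fun t => s (c (t * d))) d d0.
rewrite mul0r mul1r c0 c1; apply.
- apply: (@sheet_lift_continuous U V _ (fun t => c (t * d))) => //.
    apply: (@lipschitz_within _ _ d) => // u v /=; rewrite !in_itv/=; exact: lc.
  by move=> t /=; rewrite in_itv/= => /Uc /sP.
- by move=> u v u01 v01; rewrite (sP _ (Uc u u01)).2 (sP _ (Uc v v01)).2 lc.
Qed.

(** A path whose projection is shorter than [r] projects into an evenly covered set, so it cannot
    leave its initial sheet, where [p] is injective. *)
Lemma cover_fiber_separated : compact [set: X] ->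
  exists2 rho : R, 0 < rho & forall a b, p a = p b -> mdist a b < rho -> a = b.
Proof.
move=> cX; have [[_ _ ev] _ _] := p_cover.
have [x|r r0 rP] := @lebesgue_number _ X (evenly_covered p) cX.
  by have [U [oU Ux eU]] := ev x; exists U => //; exact: open_nbhs_nbhs.
exists r => // a b pab; rewrite -lte_fin mdist_inf => /ereal_inf_lt.
move=> [_ [c [/subspace_continuousP cc c0 c1] <-] lr].
have [U [S [pU tS SP]] Ur] := rP (p a).
have Uc t : 0 <= t <= 1 -> U (p (c t)).
  move=> t01; apply: Ur; rewrite -lte_fin; apply: le_lt_trans lr.
  by rewrite -c0; exact: (@curve_length_ge (p \o c)).
have : (p @^-1` U) a by rewrite /= -c0; apply: Uc; rewrite lexx ler01.
rewrite pU => -[V SV Va]; have [oV injV imV pV] := SP _ SV.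
suff Vb : V b by apply: injV; rewrite ?inE.
suff : V (c 0) <-> V (c 1) by rewrite c0 c1 => -[+ _]; apply.
(* Sheets are open and disjoint, so membership in [V] is locally constant along the path. *)
apply: (@cousin _ (fun u v => V (c u) <-> V (c v))) => //.
  by move=> u v w _ _ _ _ -> ->.
move=> t t01; have : (p @^-1` U) (c t) by exact: Uc.
rewrite pU => -[V' SV' V't]; have [oV' _ _ _] := SP _ SV'.
have tI : `[0, 1]%classic t by rewrite /= in_itv.
have : nbhs (c t) V' by exact: open_nbhs_nbhs.
move=> /(cc t tI); rewrite /within/= => /nbhs_ballP[e /= e0 eV'].
exists e => // u v eu ut tv ve u0 v1.
have VV' s : V' (c s) -> V (c s) <-> V = V'.
  by move=> V's; split=> [Vs|->//]; apply: tS => //; exists (c s).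
rewrite !VV' //; apply: eV'.
- by rewrite /ball/= ltr_norml; apply/andP; split; lra.
- by rewrite /= in_itv/=; apply/andP; split; move/andP: t01; lra.
- by rewrite /ball/= ltr_norml; apply/andP; split; lra.
- by rewrite /= in_itv/=; apply/andP; split; move/andP: t01; lra.
Qed.

End cover.

Arguments isometric_section {R Xt X} p rho a s.

(** * Lifting of local geodesics *)

Section lifting.
Context {R : realType} {Xt X : metricType R} {p : Xt -> X}.
Hypothesis p_cover : universal_cover p.

Definition cover_radius (rho : R) :=
  [/\ 0 < rho, forall a, exists s, isometric_section p rho a s &
      forall a b, mdist a b < rho -> mdist (p a) (p b) = mdist a b].

Lemma exists_cover_radius : compact [set: X] -> geodesic_space X ->
  exists rho, cover_radius rho.
Proof.
move=> cX gX; have [r1 r10 secP] := exists_isometric_section p_cover cX gX.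
have [r2 r20 sepP] := cover_fiber_separated p_cover cX.
(* Both [b] and the value of the section at [p b] are within [r] of [a]; half of [r2] makes these
   two points of a fiber coincide. *)
pose r := Num.min r1 (r2 / 2); have r0 : 0 < r by rewrite lt_min r10 divr_gt0.
have rr1 : r <= r1 by rewrite ge_min lexx.
have rr2 : r <= r2 / 2 by rewrite ge_min lexx orbT.
exists r; split=> // a; have [s [sa sP]] := secP a.
  exists s; split=> // y y' ry ry'; apply: sP; exact: lt_le_trans rr1.
move=> b ab; have pab := mdist_cover_le p_cover a b.
have ra : mdist (p a) (p a) < r1 by rewrite mdistxx.
have rb : mdist (p a) (p b) < r1 by lra.
have [psb dsb] := sP _ _ rb ra; have [_ dasb] := sP _ _ ra rb.
rewrite sa in dasb; suff bE : s (p b) = b by rewrite -dasb bE.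
apply: sepP => //; apply: le_lt_trans (metric_triangle _ a _) _.
by rewrite metric_sym dasb; lra.
Qed.

Lemma lift_lipschitz (c : R -> X) (c' : R -> Xt) : locally_isometric c ->
  lift_of p c c' -> forall s t, mdist (c' s) (c' t) <= `|s - t|.
Proof.
move=> ic [cc' pc'] s t; pose f u := c' (s + u * (t - s)).
have [<- <-] : f 0 = c' s /\ f 1 = c' t by rewrite /f mul0r addr0 mul1r subrKC.
apply: (mdist_path_le p_cover) => //.
  apply: (@within_comp _ R R (fun u => s + u * (t - s)) c' _ setT) => //.
    move=> u; apply: cvgD; first exact: cvg_cst.
    by apply: cvgM; [exact: cvg_id|exact: cvg_cst].
  exact: continuous_subspaceT.
move=> u v _ _; have pE w : p (c' w) = c w by rewrite -pc'.
rewrite /f !pE; apply: le_trans (locally_isometric_lipschitz ic _ _) _.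
have -> : s + u * (t - s) - (s + v * (t - s)) = (s - t) * (v - u) by ring.
by rewrite normrM (distrC v).
Qed.

Lemma half_line_lift (rho : R) (c : R -> X) (a : Xt) : cover_radius rho ->
  locally_isometric c -> p a = c 0 ->
  exists c' : R -> Xt, [/\ c' 0 = a, forall t, 0 <= t -> p (c' t) = c t &
    forall s t, 0 <= s -> s <= t -> mdist (c' s) (c' t) <= t - s].
Proof.
move=> [rho0 /choice[sec secP] _] ic pa; pose h := rho / 2.
have h0 : 0 < h by rewrite divr_gt0.
pose pts := fix pts (n : nat) := if n is m.+1 then sec (pts m) (c (m.+1%:R * h)) else a.
have near n t : n%:R * h <= t <= n.+1%:R * h -> mdist (c (n%:R * h)) (c t) < rho.
  move=> /andP[nt tn]; apply: le_lt_trans (locally_isometric_lipschitz ic _ _) _.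
  rewrite distrC ger0_norm ?subr_ge0//; move: tn nt.
  by rewrite -natr1 mulrDl mul1r /h => ? ?; lra.
have step n : n%:R * h <= n.+1%:R * h by rewrite ler_pM2r// ler_nat.
have ppts n : p (pts n) = c (n%:R * h).
  elim: n => [|n IH]; first by rewrite mul0r.
  have [_ /(_ (c (n.+1%:R * h)) (c (n.+1%:R * h)))] := secP (pts n).
  by rewrite IH => /(_ (near _ _ _) (near _ _ _)) []//; rewrite lexx step.
have secn n s t : n%:R * h <= s <= n.+1%:R * h -> n%:R * h <= t <= n.+1%:R * h ->
    p (sec (pts n) (c s)) = c s /\
    mdist (sec (pts n) (c s)) (sec (pts n) (c t)) <= `|s - t|.
  move=> ns nt; have [_ /(_ (c s) (c t))] := secP (pts n).
  rewrite ppts => /(_ (near _ _ ns) (near _ _ nt)) [-> ->]; split=> //.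
  exact: locally_isometric_lipschitz.
pose c' t := sec (pts (Num.truncn (t / h))) (c t).
have c'n n t : n%:R * h <= t <= n.+1%:R * h -> c' t = sec (pts n) (c t).
  move=> /andP[nt]; rewrite le_eqVlt => /predU1P[->|tn].
    (* At the right end [truncn] already selects the next section, whose value there is its base
       point [pts n.+1], the value of the previous one. *)
    rewrite /c' mulfK ?gt_eqF// natrK.
    have [+ _] := secP (pts n.+1); rewrite ppts => {1}->; rewrite /=.
    by [].
  by rewrite /c' (@truncn_def _ _ n)// ler_pdivlMr// ltr_pdivrMr// nt.
have tn t : 0 <= t -> exists n, n%:R * h <= t <= n.+1%:R * h.
  move=> t0; exists (Num.truncn (t / h)); have /truncn_itv : 0 <= t / h by rewrite divr_ge0// ltW.
  by rewrite ler_pdivlMr// ltr_pdivrMr// => /andP[-> /ltW ->].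
exists c'; split.
- rewrite (c'n 0%N) ?mul0r ?lexx//=; last by rewrite mul1r ltW.
  by have [+ _] := secP a; rewrite pa.
- move=> t /tn[n nt]; rewrite (c'n n)//.
  by have [] := secn n t t nt nt.
- move=> s t s0 st; have [n /andP[_]] := tn t (le_trans s0 st).
  elim: n.+1 s t s0 st => {n} [|n IH] s t s0 st tn'.
    have t0 : t <= 0 by move: tn'; rewrite mul0r.
    have -> : s = t by lra.
    by rewrite mdistxx subrr.
  have piece u v : n%:R * h <= u -> u <= v -> v <= n.+1%:R * h -> mdist (c' u) (c' v) <= v - u.
    move=> nu uv vn; have nu' : n%:R * h <= u <= n.+1%:R * h by rewrite nu (le_trans uv).
    have nv' : n%:R * h <= v <= n.+1%:R * h by rewrite vn (le_trans nu).
    rewrite (c'n n u)// (c'n n v)//; have [_] := secn n u v nu' nv'.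
    by rewrite distrC ger0_norm ?subr_ge0.
  have [tn''|nt] := leP t (n%:R * h); first exact: IH.
  have [sn|ns] := leP (n%:R * h) s; first exact: piece.
  apply: le_trans (metric_triangle _ (c' (n%:R * h)) _) _.
  have := IH s (n%:R * h) s0 (ltW ns) (lexx _).
  by have := piece (n%:R * h) t (lexx _) (ltW nt) tn'; lra.
Qed.

Lemma line_lift (rho : R) (c : R -> X) (a : Xt) : cover_radius rho ->
  locally_isometric c -> p a = c 0 ->
  exists2 c' : R -> Xt, lift_of p c c' & c' 0 = a.
Proof.
move=> rhoP ic pa; have [f [f0 pf lf]] := half_line_lift rhoP ic pa.
have icN : locally_isometric (fun t => c (- t)).
  move=> t; have [e e0 ie] := ic (- t); exists e => // s u se ue.
  have oppB (w v : R) : - w - - v = - (w - v) by rewrite opprD.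
  by rewrite ie ?oppB ?normrN.
have paN : p a = c (- 0) by rewrite oppr0.
have [g [g0 pg lg]] := half_line_lift rhoP icN paN.
pose c' t := if 0 <= t then f t else g (- t).
have lip s t : s <= t -> mdist (c' s) (c' t) <= t - s.
  move=> st; rewrite /c'; case: (leP 0 s) => [s0|s0].
    by rewrite (le_trans s0 st); exact: lf.
  case: (leP 0 t) => [t0|t0]; last first.
    rewrite metric_sym; have := @lg (- t) (- s); rewrite oppr_ge0 lerN2 opprK addrC.
    by apply => //; exact: ltW.
  apply: le_trans (metric_triangle _ a _) _; rewrite -{1}g0 -f0 metric_sym.
  have := lg 0 (- s) (lexx _); have := lf 0 t (lexx _) t0.
  by rewrite oppr_ge0 (ltW s0) !subr0 => h1 /(_ isT) h2; lra.
exists c'; last by rewrite /c' lexx.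
split.
  apply: lipschitz1_continuous => s t; have [st|/ltW ts] := leP s t.
    by rewrite distrC ger0_norm ?subr_ge0//; exact: lip.
  by rewrite metric_sym ger0_norm ?subr_ge0//; exact: lip.
apply/funext => t; rewrite /c' /=; case: leP => t0; first exact: pf.
by rewrite pg ?opprK// oppr_ge0 ltW.
Qed.

End lifting.

Arguments cover_radius {R Xt X} p rho.

(** * The metric of the space of geodesics *)

Section weighted_integral.
Context {R : realType}.
Notation mu := (@lebesgue_measure R).

Lemma continuous_exp_normN (k : R) : continuous (fun t : R => expR (- (k * `|t|))).
Proof.
move=> t; apply: continuous_comp; last exact: continuous_expR.
apply: cvgN; apply: cvgM; first exact: cvg_cst.
exact: norm_continuous.
Qed.

(** Each half line contributes at most the mass of the exponential law of parameter 1. *)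
Lemma integral_exp_normN : (\int[mu]_t (expR (- `|t|))%:E <= 2%:E)%E.
Proof.
have cf : continuous (fun t : R => expR (- `|t|)).
  have := @continuous_exp_normN 1; rewrite (_ : (fun t => _) = (fun t : R => expR (- `|t|)))//.
  by apply/funext => t; rewrite mul1r.
rewrite (ge0_symfun_integralT (fun=> expR_ge0 _) cf); last first.
  by move=> x /=; rewrite normrN.
rewrite -[X in (_ <= X)%E]mule1 lee_wpmul2l ?lee_fin//.
have mpos : measurable [set x : R | 0 <= x] by rewrite -set_itvcy.
rewrite -(@integral_exponential_pdf R 1 ltr01).
apply: (@le_trans _ _ (\int[mu]_(x in [set x | (0 <= x)%R]) (exponential_pdf 1 x)%:E)%E).
  apply: ge0_le_integral => //.
  - by apply/measurable_EFinP; apply: measurable_funTS; exact: continuous_measurable_fun.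
  - apply/measurable_EFinP; apply: measurable_funTS; exact: measurable_exponential_pdf.
  - by move=> x /= x0; rewrite lee_fin exponential_pdfE//= mul1r mulN1r ger0_norm.
apply: ge0_subset_integral => //.
  by apply/measurable_EFinP; exact: measurable_exponential_pdf.
by move=> x _; rewrite lee_fin exponential_pdf_ge0.
Qed.

(** The bound on [D] fits 2-Lipschitz functions that are at most [e] on [[-K, K]], as [s <= expR s].
    One half of the weight absorbs the exponential, the other is integrable. *)
Lemma weighted_integral_le (D : R -> R) (e K : R) : 0 <= e ->
  continuous D -> (forall t, 0 <= D t <= e + 2 * expR (`|t| - K)) ->
  (\int[mu]_t (D t * expR (- (2 * `|t|)))%:E <= (2 * (e + 2 * expR (- K)))%:E)%E.
Proof.
move=> e0 cD De; have k0 : 0 <= e + 2 * expR (- K) by rewrite addr_ge0 ?mulr_ge0 ?expR_ge0.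
have cE : continuous (fun t : R => expR (- `|t|)).
  have := @continuous_exp_normN 1; rewrite (_ : (fun t => _) = (fun t : R => expR (- `|t|)))//.
  by apply/funext => t; rewrite mul1r.
apply: (@le_trans _ _ (\int[mu]_t ((e + 2 * expR (- K))%:E * (expR (- `|t|))%:E))%E).
  apply: ge0_le_integral => //.
  - by move=> t _; rewrite lee_fin mulr_ge0 ?expR_ge0//; case/andP: (De t).
  - apply/measurable_EFinP; apply: continuous_measurable_fun => t.
    by apply: cvgM; [exact: cD|exact: continuous_exp_normN].
  - apply/measurable_EFinP; apply: measurable_funM => //.
    exact: continuous_measurable_fun.
  - move=> t _; rewrite -EFinM lee_fin.
    have /andP[_ Dt] := De t.
    apply: (@le_trans _ _ ((e + 2 * expR (`|t| - K)) * expR (- (2 * `|t|)))).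
      by rewrite ler_wpM2r// expR_ge0.
    rewrite !mulrDl; apply: lerD.
      by rewrite ler_wpM2l// ler_expR lerN2; have := normr_ge0 t; lra.
    by rewrite -!mulrA -!expRD le_eqVlt (_ : `|t| - K - _ = - K - `|t|) ?eqxx//; ring.
rewrite ge0_integralZl_EFin//; last first.
  by apply/measurable_EFinP; exact: continuous_measurable_fun.
rewrite (mulrC 2 (e + _)) EFinM lee_wpmul2l ?lee_fin//.
exact: integral_exp_normN.
Qed.

(** The bound is the height [e / 2], times the least possible weight on the interval of radius
    [e / 4] about [t0], times its length. A 2-Lipschitz [D] with [e <= D t0] qualifies. *)
Lemma weighted_integral_ge (D : R -> R) (e K t0 : R) : 0 < e -> continuous D ->
  (forall t, 0 <= D t) -> `|t0| <= K ->
  (forall t, `|t - t0| <= e / 4 -> e / 2 <= D t) ->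
  ((e / 2 * expR (- (2 * (K + e / 4))) * (e / 2))%:E <=
    \int[mu]_t (D t * expR (- (2 * `|t|)))%:E)%E.
Proof.
move=> e0 cD D0 tK De; set k := e / 2 * _.
have k0 : 0 <= k by rewrite mulr_ge0 ?expR_ge0// divr_ge0// ltW.
pose J : set R := `[t0 - e / 4, t0 + e / 4]%classic.
have mI : measurable J by exact: measurable_itv.
have mf : measurable_fun setT (fun t => (D t * expR (- (2 * `|t|)))%:E).
  apply/measurable_EFinP; apply: continuous_measurable_fun => t.
  by apply: cvgM; [exact: cD|exact: continuous_exp_normN].
apply: (@le_trans _ _ (\int[mu]_(t in J) (D t * expR (- (2 * `|t|)))%:E)%E); last first.
  apply: ge0_subset_integral => // t _; rewrite lee_fin mulr_ge0 ?expR_ge0//.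
apply: (@le_trans _ _ (\int[mu]_(t in J) (cst k%:E) t)%E).
  have muJ : mu J = (e / 2)%:E.
    rewrite lebesgue_measure_itv/= lte_fin ifT; last by lra.
    by rewrite -EFinB; congr _%:E; lra.
  by rewrite integral_cst// [X in (_ <= _ * X)%E]muJ -EFinM.
apply: ge0_le_integral => //.
- exact: measurable_funTS.
move=> t; rewrite /J /= in_itv/= => /andP[t1 t2]; rewrite lee_fin.
have tt0 : `|t - t0| <= e / 4 by rewrite ler_norml; apply/andP; split; lra.
apply: ler_pM; rewrite ?expR_ge0 ?De//; first lra.
rewrite ler_expR lerN2 ler_pM2l//.
by have := ler_distD t0 t 0; rewrite !subr0; lra.
Qed.

End weighted_integral.

Definition line_close {R : realType} {X : metricType R} (K e : R) (c1 c2 : R -> X) :=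
  forall t, `|t| <= K -> mdist (c1 t) (c2 t) < e.

Section dGX.
Context {R : realType} {Xt X : metricType R} {p : Xt -> X}.
Hypotheses (p_cover : universal_cover p) (cX : compact [set: X])
  (gX : geodesic_space X).
Implicit Types (c : GX p).

Let lifted c1 c2 := [set lifted_distance g.1 g.2
  | g in [set g : (R -> Xt) * (R -> Xt) | lift_of p c1 g.1 /\ lift_of p c2 g.2]].

Let lifted_ge0 c1 c2 : (0 <= ereal_inf (lifted c1 c2))%E.
Proof.
apply: le_ereal_inf_tmp => _ [g _ <-]; apply: integral_ge0 => t _.
by rewrite lee_fin mulr_ge0 ?mdist_ge0 ?expR_ge0.
Qed.

Let lip2 (c1 c2 : GX p) g1 g2 : lift_of p c1 g1 -> lift_of p c2 g2 ->
  forall s t, `|mdist (g1 s) (g2 s) - mdist (g1 t) (g2 t)| <= 2 * `|s - t|.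
Proof.
move=> l1 l2 s t; apply: le_trans (mdist_lipschitz _ _ _ _) _.
by rewrite mulr_natl mulr2n; apply: lerD; apply: (lift_lipschitz p_cover);
  [exact: (lineP c1)|exact: l1|exact: (lineP c2)|exact: l2].
Qed.

Let lifted_le c1 c2 g1 g2 (e K : R) : lift_of p c1 g1 -> lift_of p c2 g2 ->
  0 <= e -> (forall t, mdist (g1 t) (g2 t) <= e + 2 * expR (`|t| - K)) ->
  (lifted_distance g1 g2 <= (2 * (e + 2 * expR (- K)))%:E)%E.
Proof.
move=> l1 l2 e0 ge; apply: weighted_integral_le => // [|t]; last by rewrite mdist_ge0 ge.
by apply: (@lipschitz_continuous _ 2); exact: lip2 l1 l2.
Qed.

Lemma ex_lift c (a : Xt) : p a = c 0 -> exists2 g, lift_of p c g & g 0 = a.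
Proof.
have [r rP] := exists_cover_radius p_cover cX gX.
exact: line_lift rP (lineP c).
Qed.

Lemma ex_fiber (x : X) : exists a, p a = x.
Proof.
have [[_ pT _] _ _] := p_cover.
have : range p x by rewrite pT.
by case=> a _ <-; exists a.
Qed.

(** The projection does not increase distances, so a gap [e] in [X] at one time is a gap for every
    pair of lifts. *)
Lemma dGX_close (K e : R) : 0 < e ->
  exists2 d : R, 0 < d & forall c1 c2, dGX p c1 c2 < d -> line_close K e c1 c2.
Proof.
move=> e0; exists (e / 2 * expR (- (2 * (K + e / 4))) * (e / 2)).
  by rewrite !mulr_gt0 ?expR_gt0.
move=> c1 c2 d12 t0 tK; rewrite ltNge; apply/negP => ed.
have [a1 pa1] := ex_fiber (c1 0); have [a2 pa2] := ex_fiber (c2 0).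
have [g1 l1 g10] := ex_lift pa1; have [g2 l2 g20] := ex_lift pa2.
(* Since [fine] would turn an infinite infimum into 0, finiteness comes first: the distance between
   two lifts grows at most linearly. *)
have inf_fin : ereal_inf (lifted c1 c2) \is a fin_num.
  rewrite ge0_fin_numE ?lifted_ge0//.
  apply: le_lt_trans (_ : lifted_distance g1 g2 < +oo)%E.
    by apply: ereal_inf_lbound; exists (g1, g2).
  apply: (@le_lt_trans _ _ (2 * (mdist a1 a2 + 2 * expR (- 0)))%:E); last exact: ltry.
  apply: (lifted_le l1 l2 (mdist_ge0 _ _)) => t; rewrite subr0.
  have := lip2 l1 l2 t 0; rewrite g10 g20 subr0 ler_norml => /andP[_].
  by have := expR_ge1Dx `|t|; lra.
move: d12; rewrite /dGX -/(lifted c1 c2) -lte_fin fineK// => /ereal_inf_lt.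
move=> [_ [[h1 h2] /= [m1 m2] <-]]; rewrite ltNge => /negP; apply.
apply: (@weighted_integral_ge _ (fun t => mdist (h1 t) (h2 t)) e K t0) => //.
- by apply: (@lipschitz_continuous _ 2); exact: lip2 m1 m2.
- by move=> t; exact: mdist_ge0.
move=> t te; have pE (c : GX p) h u : lift_of p c h -> p (h u) = c u by case=> _ <-.
apply: le_trans (mdist_cover_le p_cover _ _); rewrite (pE c1 h1)// (pE c2 h2)//.
have := mdist_lipschitz (c1 t0) (c2 t0) (c1 t) (c2 t).
have := locally_isometric_lipschitz (lineP c1) t0 t.
have := locally_isometric_lipschitz (lineP c2) t0 t.
by rewrite (distrC t0) ler_norml => h3 h4 /andP[_]; lra.
Qed.

(** Lifts that start close stay close as long as their projections do, [p] being isometric below the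
    scale [r]; outside [[-K, K]] the weight takes over. *)
Lemma close_dGX (d : R) : 0 < d -> exists K e : R,
  [/\ 0 < K, 0 < e & forall c1 c2, line_close K e c1 c2 -> dGX p c1 c2 < d].
Proof.
move=> d0; have [r rP] := exists_cover_radius p_cover cX gX; have [r0 secr isor] := rP.
have [K K0 Kd] : exists2 K : R, 0 < K & expR (- K) < d / 8.
  (* By [1 + x <= expR x] at [8 / d]. The final bound is less than [2 * (d / 8 + 2 * (d / 8))],
     hence than [d]. *)
  exists (8 / d); first by rewrite divr_gt0.
  rewrite expRN -[X in _ < X]invrK ltf_pV2 ?posrE ?expR_gt0 ?invr_gt0 ?divr_gt0//.
  by rewrite invf_div; apply: lt_le_trans (expR_ge1Dx _); rewrite ltrDr.
pose e := Num.min (r / 2) (d / 8).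
have e0 : 0 < e by rewrite lt_min !divr_gt0.
have er : e <= r / 2 by rewrite ge_min lexx.
have ed : e <= d / 8 by rewrite ge_min lexx orbT.
exists K, e; split=> // c1 c2 cl.
have [a pa] := ex_fiber (c1 0); have [g1 l1 g10] := ex_lift pa.
have cl0 : mdist (c1 0) (c2 0) < e by apply: cl; rewrite normr0 ltW.
have [s [sa sP]] := secr a; rewrite pa in sa sP.
have [] := sP (c2 0) (c1 0); rewrite ?mdistxx//; first by lra.
have [_] := sP (c1 0) (c2 0) ltac:(by rewrite mdistxx) ltac:(lra).
rewrite sa => das pb _; have [g2 l2 g20] := ex_lift pb.
have pE (c : GX p) h u : lift_of p c h -> p (h u) = c u by case=> _ <-.
have D0 : mdist (g1 0) (g2 0) < e by rewrite g10 g20 das.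
have Dstep u v : u <= v -> - K <= u -> v <= K ->
    mdist (g1 u) (g2 u) < e <-> mdist (g1 v) (g2 v) < e.
  move=> uv Ku vK.
  apply: (@cousin _ (fun u v => mdist (g1 u) (g2 u) < e <-> mdist (g1 v) (g2 v) < e)) => //.
    by move=> ? ? ? _ _ _ _ -> ->.
  move=> t /andP[ut tv]; exists (r / 8); first by rewrite divr_gt0.
  move=> s1 s2 ts1 s1t ts2 s2t us1 s2v.
  (* Over a time less than [r / 4] the distance upstairs changes by less than [r / 2], so it remains
     below [r], where it equals the distance in [X]. *)
  have ext w w' : `|w| <= K -> `|w' - w| < r / 4 ->
      mdist (g1 w') (g2 w') < e -> mdist (g1 w) (g2 w) < e.
    move=> wK ww' ew'; rewrite -isor ?(pE c1 g1)// ?(pE c2 g2)//; first exact: cl.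
    have := lip2 l1 l2 w' w; rewrite ler_norml => /andP[+ _].
    by move: ww' ew'; lra.
  by split; apply: ext; rewrite ?ler_norml ?ltr_norml; apply/andP; split; lra.
have DK t : `|t| <= K -> mdist (g1 t) (g2 t) < e.
  rewrite ler_norml => /andP[Kt tK]; have [t0|/ltW t0] := leP 0 t.
    by have [] := Dstep 0 t t0 ltac:(lra) tK => + _; apply.
  by have [] := Dstep t 0 t0 Kt ltac:(lra) => _; apply.
have Dall t : mdist (g1 t) (g2 t) <= e + 2 * expR (`|t| - K).
  have E0 := expR_ge0 (`|t| - K).
  have [tK|Kt] := leP `|t| K; first by have := DK t tK; lra.
  pose w := if 0 <= t then K else - K.
  have wK : `|w| <= K by rewrite /w; case: ifP => _; rewrite ?normrN ger0_norm// ltW.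
  have tw : `|t - w| = `|t| - K.
    rewrite /w; case: leP => t0.
      by rewrite (ger0_norm t0) in Kt *; rewrite ger0_norm// subr_ge0 ltW.
    by rewrite (ltr0_norm t0) in Kt *; rewrite ltr0_norm; lra.
  have := lip2 l1 l2 t w; rewrite tw ler_norml => /andP[_].
  by have := DK w wK; have := expR_ge1Dx (`|t| - K); lra.
have le := lifted_le l1 l2 (ltW e0) Dall.
have inf_le : (ereal_inf (lifted c1 c2) <= (2 * (e + 2 * expR (- K)))%:E)%E.
  by apply: le_trans le; apply: ereal_inf_lbound; exists (g1, g2).
rewrite /dGX -/(lifted c1 c2) -lte_fin fineK.
  by apply: le_lt_trans inf_le _; rewrite lte_fin; lra.
by rewrite ge0_fin_numE ?lifted_ge0// (le_lt_trans inf_le)// ltry.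
Qed.

End dGX.

(** * Subshifts and suspensions *)

Lemma compact_set_type {T : topologicalType} (A : set T) :
  compact A -> compact [set: set_type A].
Proof.
move=> /compact_near_coveringP/near_covering_withinP cA.
apply/compact_near_coveringP => I F P FF Pnear.
have : \near F, A `<=` (fun y => forall Ay : y \in A, P F (exist _ y Ay)).
  apply: cA => y Ay; have [[U V] [/= Ux FV] UV] := Pnear (exist _ y (mem_set Ay)) Logic.I.
  move: Ux; rewrite nbhsE => -[U' [[B oB BU'] U'y] U'U].
  exists (B, V) => [|[z i] /= [Bz Vi] Az Az'].
    by split=> //; apply: open_nbhs_nbhs; split=> //; move: U'y; rewrite -BU'.
  by apply: (UV (exist _ z Az', i)); split=> //=; apply: U'U; rewrite -BU'.
apply: filterS => i Pi [y Ay] _; exact: (Pi y (set_mem Ay) Ay).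
Qed.

Section shift_space.
Context {A : finType}.
Implicit Types (x y : full_shift A).

Definition agree (N : nat) (x y : int -> A) :=
  forall k : int, - N%:Z <= k <= N%:Z -> x k = y k.

Lemma near_coordinate x (k : int) : \forall y \near x, y k = x k.
Proof.
have := @proj_continuous int (fun=> discrete_topology A) k x [set a | a = x k].
by apply; rewrite /= nbhs_principalE => _ ->.
Qed.

Lemma near_coordinates x (s : seq int) :
  \forall y \near x, forall k, k \in s -> y k = x k.
Proof.
elim: s => [|k s IH]; first by near=> y.
near=> y => j; rewrite inE => /orP[/eqP ->|]; first by near: y; exact: near_coordinate.
by move: j; near: y.
Unshelve. all: end_near. Qed.

Lemma compact_sft (W : seq (seq A)) : compact (sft W).
Proof.
apply: (@subclosed_compact _ _ [set: full_shift A]) => //; last first.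
  have := @tychonoff int (fun=> discrete_topology A) (fun=> setT).
  rewrite (_ : [set f | _] = setT); last by apply/seteqP.
  by apply=> _; apply: finite_compact; exact: finite_finset.
rewrite -openC openE => x /= nWx.
have [w [n [wW ex]]] : exists w n, w \in W /\ subword x n (size w) = w.
  apply: contrapT => H; apply: nWx => w n wW; apply/negP => /eqP ex.
  by apply: H; exists w, n.
have := near_coordinates x [seq n + i%:Z | i <- iota 0 (size w)].
rewrite /interior; apply: filterS => y yx Wy.
have /eqP := Wy w n wW; apply; rewrite -[RHS]ex.
by apply/eq_in_map => i i_w; apply: yx; apply: map_f.
Qed.

End shift_space.

Lemma compact_susp_domain {R : realType} {A : finType} (W : seq (seq A)) :
  compact [set: @susp_domain R A W].
Proof.
rewrite -setXTT; apply: compact_setX.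
  exact/compact_set_type/compact_sft.
exact/compact_set_type/segment_compact.
Qed.

(** For the topology [dist_open], a ball need not be open a priori. The set [O] leaves a uniform
    slack [e - e'], which makes it open. *)
Lemma nbhs_close {R : realType} {Xt X : metricType R} {p : Xt -> X}
    (c : GX p) (K e : R) : universal_cover p -> compact [set: X] ->
  geodesic_space X -> 0 < e -> nbhs c [set c' : GX p | line_close K e c c'].
Proof.
move=> p_cover cX gX e0.
pose O := [set c' : GX p | exists2 e', e' < e &
  forall t, `|t| <= K -> mdist (c t) (c' t) <= e'].
have Oc : O c by exists 0 => // t _; rewrite mdistxx.
have oO : open O.
  move=> c' [e' e'e cc']; have [|d d0 dP] := dGX_close p_cover cX gX K (e := (e - e') / 2).
    by rewrite divr_gt0 ?subr_gt0.
  exists d => // c'' /dP cl; exists (e' + (e - e') / 2); first lra.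
  move=> t tK; apply: le_trans (metric_triangle _ (c' t) _) _.
  by have := cl t tK; have := cc' t tK; lra.
apply: filterS (open_nbhs_nbhs (conj oO Oc)) => c' [e' e'e cc'] t tK.
exact: le_lt_trans (cc' t tK) _.
Qed.

(** * Orbits of the suspension flow *)

Section suspension_orbits.
Context {R : realType} {A : finType} {W : seq (seq A)}.
Implicit Types (x : sft W) (t : R).

Lemma sft_power0 x : sft_power 0 x = x.
Proof. by apply: val_inj => /=; apply/funext => n; rewrite /Defs.shift addr0. Qed.

Lemma sft_powerD m n x : sft_power (m + n) x = sft_power m (sft_power n x).
Proof. by apply: val_inj => /=; apply/funext => k; rewrite /Defs.shift -addrA. Qed.

Definition susp_point x (s : R) (s01 : `[0, 1]%classic s) : Susp R W :=
  \pi_(Susp R W) ((x, exist _ s (mem_set s01)) : @susp_domain R A W).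

Lemma itv01_0 : `[0, 1]%classic (0 : R).
Proof. by rewrite /= in_itv/= lexx ler01. Qed.

Definition susp_orbit x (t : R) : Susp R W :=
  susp_flow R W t (susp_point x itv01_0).

Lemma susp_orbitE x t : susp_orbit x t =
  susp_point (sft_power (Num.floor t) x) (frac_part_itv t).
Proof.
rewrite /susp_orbit /susp_point susp_flow_pi /susp_domain_flow /=.
by congr (\pi_(Susp R W) (_, _)); [rewrite add0r|apply: val_inj; rewrite /= add0r].
Qed.

Lemma susp_orbit_shift x t (n : int) :
  susp_orbit x (t + n%:~R) = susp_orbit (sft_power n x) t.
Proof.
have fl : Num.floor (t + n%:~R) = Num.floor t + n by rewrite floorDrz ?intrKfloor// ?intr_int.
rewrite !susp_orbitE /susp_point fl sft_powerD.
congr (\pi_(Susp R W) (_, _)); apply: val_inj => /=.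
by rewrite /frac_part fl intrD; ring.
Qed.

Lemma susp_orbit_itv x (s : R) (s01 : `[0, 1]%classic s) :
  susp_orbit x s = susp_point x s01.
Proof.
rewrite susp_orbitE; have := s01; rewrite /= in_itv/= => /andP[s0].
rewrite le_eqVlt => /predU1P[s1|s1].
  (* At height 1 the flow gives the shifted sequence at height 0; the two points are glued. *)
  have fs : Num.floor s = 1 by rewrite s1 floor1.
  apply/esym/eqmodP/asboolP; apply: rst_step.
  by split=> //=; rewrite ?fs// /frac_part fs s1 subrr.
have fs : Num.floor s = 0 by apply/floor_def; rewrite s0.
rewrite /susp_point fs sft_power0; congr (\pi_(Susp R W) (_, _)).
by apply: val_inj; rewrite /= /frac_part fs subr0.
Qed.

Lemma susp_orbitD x (s t : R) :
  susp_flow R W s (susp_orbit x t) = susp_orbit x (t + s).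
Proof.
rewrite [in LHS]susp_orbitE /susp_point susp_flow_pi /susp_domain_flow /=.
have fl : Num.floor (t + s) = Num.floor (frac_part t + s) + Num.floor t.
  rewrite [X in Num.floor X](_ : _ = frac_part t + s + (Num.floor t)%:~R).
    by rewrite floorDrz ?intr_int// intrKfloor.
  by rewrite /frac_part; ring.
rewrite susp_orbitE /susp_point fl sft_powerD; congr (\pi_(Susp R W) (_, _)).
have fracE (u : R) : frac_part u = u - (Num.floor u)%:~R by [].
apply: val_inj; rewrite /= (fracE (t + s)) (fracE (frac_part t + s)) fl intrD.
by rewrite (fracE t); ring.
Qed.

Lemma susp_point_surj (z : Susp R W) :
  exists x s (s01 : `[0, 1]%classic s), z = susp_point x s01.
Proof.
rewrite -[z]reprK; case: (repr z) => x [s s01].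
exists x, s, (set_mem s01); congr (\pi_(Susp R W) (_, _)).
exact: val_inj.
Qed.

Lemma susp_orbit_surj (z : Susp R W) :
  exists x s, 0 <= s <= 1 /\ z = susp_orbit x s.
Proof.
have [x [s [s01 ->]]] := susp_point_surj z; exists x, s; split.
  by move: s01; rewrite /= in_itv.
by rewrite (susp_orbit_itv x s01).
Qed.

End suspension_orbits.

(** * Images of suspension orbits in the space of geodesics *)

Section orbit_lines.
Context {R : realType} {Xt X : metricType R} {p : Xt -> X} {A : finType}
  {W : seq (seq A)} {h : Susp R W -> GX p}.
Hypotheses (p_cover : universal_cover p) (cX : compact [set: X])
  (gX : geodesic_space X)
  (hP : orbit_semi_equivalence (susp_flow R W) (geodesic_flow p) h).
Implicit Types (x y : sft W).

Local Notation g := (geodesic_flow p).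

(* The parametrization of the orbit of [(x, 0)] is that of the suspension, not
   that of the geodesic flow. *)
Definition orbit_line x (t : R) : GX p := h (susp_orbit x t).

Lemma eq_line (c c' : GX p) : (forall t : R, c t = c' t) -> c = c'.
Proof.
case: c c' => [c ic] [c' ic'] /= /funext cc'; move: ic ic'; rewrite cc' => ic ic'.
by congr GeodesicLine; exact: Prop_irrelevance.
Qed.

Lemma geodesic_flowD s t (c : GX p) : g s (g t c) = g (t + s) c.
Proof. by apply: eq_line => u /=; rewrite -addrA (addrC s). Qed.

Lemma geodesic_flow0 (c : GX p) : g 0 c = c.
Proof. by apply: eq_line => u /=; rewrite addr0. Qed.

Lemma orbit_line_shift x t (n : int) :
  orbit_line x (t + n%:~R) = orbit_line (sft_power n x) t.
Proof. by rewrite /orbit_line susp_orbit_shift. Qed.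

Lemma orbit_line_surj (c : GX p) : exists x s, 0 <= s <= 1 /\ c = orbit_line x s.
Proof.
have [_ hT _] := hP; have : range h c by rewrite hT.
case=> z _ <-; have [x [s [s01 ->]]] := susp_orbit_surj z.
by exists x, s.
Qed.

Lemma orbit_line_local x t : exists (e : R) (alpha : R -> R),
  [/\ 0 < e, alpha 0 = 0, {within `]-e, e[, continuous alpha},
      {in `]-e, e[ &, {homo alpha : u v / u < v}} &
      {in `]-e, e[, forall s, orbit_line x (t + s) = g (alpha s) (orbit_line x t)} /\
      {in `]-e, e[ &, injective (fun s => orbit_line x (t + s))}].
Proof.
have [_ _ /(_ (susp_orbit x t))[_]] := hP.
move=> [e [alpha [e0 a0 ca ha [ga ia]]]]; exists e, alpha; split=> //; split.
  by move=> s se; rewrite /orbit_line -susp_orbitD ga.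
by move=> s s' se s'e; rewrite /orbit_line -!susp_orbitD; exact: ia.
Qed.

(** Uniform continuity, by compactness of the square of the domain before glueing. Near the diagonal
    it is continuity; near a pair of distinct points, which differ in a coordinate or in height, the
    hypotheses fail for large [N]. *)
Lemma orbit_line_unif (K e : R) : 0 < e -> exists N : nat, forall x y s t,
  agree N (val x) (val y) -> 0 <= s <= 1 -> 0 <= t <= 1 ->
  `|s - t| <= N.+1%:R^-1 -> line_close K e (orbit_line x s) (orbit_line y t).
Proof.
move=> e0.
pose D := (@susp_domain R A W); pose F (a : D) : GX p := h (\pi_(Susp R W) a).
have cF : continuous F.
  by move=> a; apply: continuous_comp; [exact: pi_continuous|case: hP => + _ _; apply].
have cD : compact [set: D * D].
  by rewrite -setXTT; apply: compact_setX; exact: compact_susp_domain.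
pose P (N : nat) (ab : D * D) := agree N (val ab.1.1) (val ab.2.1) ->
  `|val ab.1.2 - val ab.2.2| <= N.+1%:R^-1 -> line_close K e (F ab.1) (F ab.2).
have : \forall N \near \oo, [set: D * D] `<=` P N.
  move/compact_near_coveringP: cD; apply => -[a b] _.
  have [ab|ab] := eqVneq a b.
    have U : nbhs (F a) [set c | line_close K (e / 2) (F a) c].
      by apply: nbhs_close => //; rewrite divr_gt0.
    have {}U := cF a _ U; rewrite -ab.
    exists ([set cd : D * D | line_close K (e / 2) (F a) (F cd.1) /\
      line_close K (e / 2) (F a) (F cd.2)], setT) => /=.
      split; last exact: filterT.
      by exists ([set c | line_close K (e / 2) (F a) (F c)],
        [set c | line_close K (e / 2) (F a) (F c)]) => // -[? ?] [].
    move=> [[c d] N] /= [[ac ad] _] _ _ t tK.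
    apply: le_lt_trans (metric_triangle _ (F a t) _) _.
    by rewrite metric_sym (splitr e) ltrD; [|exact: ac|exact: ad].
  have val_cont1 : continuous (fun c : D => val c.1).
    move=> c; apply: (@continuous_comp D (sft W : Type) (full_shift A) fst set_val).
      exact: cvg_fst.
    exact: initial_continuous.
  have val_cont2 : continuous (fun c : D => val c.2).
    move=> c; apply: (@continuous_comp D (@unit_itv R) R snd set_val).
      exact: cvg_snd.
    exact: initial_continuous.
  have [[k abk]|ab1] := pselect (exists k, val a.1 k != val b.1 k).
    exists ([set cd : D * D | val cd.1.1 k = val a.1 k /\ val cd.2.1 k = val b.1 k],
      [set N | (`|k|%N <= N)%N]) => /=.
      split; last by exists `|k|%N => //.
      exists ([set c : D | val c.1 k = val a.1 k], [set c : D | val c.1 k = val b.1 k]) => //=.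
      by split; [exact: val_cont1 a _ (near_coordinate _ k)
                |exact: val_cont1 b _ (near_coordinate _ k)].
    move=> [[c d] N] /= [[ck dk] kN] cd _; case/eqP: abk.
    transitivity (val c.1 k); first exact: esym.
    by transitivity (val d.1 k) => //; apply: cd; lia.
  have ab2 : 0 < `|val a.2 - val b.2| / 3.
    rewrite divr_gt0// normr_gt0 subr_eq0; apply/eqP => ab2; move/eqP: ab; apply.
    apply: injective_projections; last exact: val_inj.
    apply: val_inj; apply/funext => k; apply: contrapT => abk; apply: ab1.
    by exists k; apply/eqP.
  set eta := _ / 3 in ab2.
  have nearv (c : D) : nbhs c [set c' : D | `|val c'.2 - val c.2| < eta].
    apply: (val_cont2 c [set s | `|s - val c.2| < eta]).
    by apply/nbhs_ballP; exists eta => //= s; rewrite /ball/= distrC.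
  exists ([set cd : D * D | `|val cd.1.2 - val a.2| < eta /\ `|val cd.2.2 - val b.2| < eta],
      [set N | N.+1%:R^-1 < eta]) => /=.
    split; last exact: (near_infty_natSinv_lt (PosNum ab2)).
    by exists ([set c : D | `|val c.2 - val a.2| < eta],
      [set c : D | `|val c.2 - val b.2| < eta]).
  move=> [[c d] N] /= [[ca db] Neta] _ cd; exfalso.
  have {}ca : `|val c.2 - val a.2| < eta := ca.
  have {}db : `|val d.2 - val b.2| < eta := db.
  have {}cd : `|val c.2 - val d.2| <= N.+1%:R^-1 := cd.
  have : `|val a.2 - val b.2| < 3 * eta.
    move: ca db (le_lt_trans cd Neta); rewrite !ltr_norml.
    by move=> /andP[? ?] /andP[? ?] /andP[? ?]; apply/andP; split; lra.
  by rewrite /eta mulrC divfK ?ltxx.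
move=> [N _ /(_ N (leqnn N)) PN]; exists N => x y s t xy s01 t01 st.
have s01' : `[0, 1]%classic s by rewrite /= in_itv.
have t01' : `[0, 1]%classic t by rewrite /= in_itv.
rewrite /orbit_line (susp_orbit_itv x s01') (susp_orbit_itv y t01').
exact: (PN ((x, exist _ s (mem_set s01')), (y, exist _ t (mem_set t01'))) I xy st).
Qed.

End orbit_lines.

Arguments orbit_line {R Xt X p A W} h x t.

(** * Time changes *)

Section time_change.
Context {R : realType} {Xt X : metricType R} {p : Xt -> X} {A : finType}
  {W : seq (seq A)} {h : Susp R W -> GX p}.
Hypotheses (p_cover : universal_cover p) (cX : compact [set: X])
  (gX : geodesic_space X)
  (hP : orbit_semi_equivalence (susp_flow R W) (geodesic_flow p) h).
Implicit Types (x y : sft W).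

Local Notation g := (geodesic_flow p).
Local Notation Phi := (orbit_line h).

(* [h] maps the orbit segment from time [u] to time [v] onto the segment of
   length [tau] of the geodesic flow.  Since [tau] need not be unique on a
   periodic orbit, both inclusions are recorded with the same [tau]. *)
Definition orbit_arc x (u v tau : R) :=
  [/\ 0 <= tau, Phi x v = g tau (Phi x u),
      forall s, 0 <= s <= tau -> exists2 w, u <= w <= v & Phi x w = g s (Phi x u) &
      forall w, u <= w <= v -> exists2 s, 0 <= s <= tau & Phi x w = g s (Phi x u)].

Lemma orbit_arc_trans x u v w s t : u <= v -> v <= w -> orbit_arc x u v s -> orbit_arc x v w t ->
  orbit_arc x u w (s + t).
Proof.
move=> uv vw [s0 uvE uv1 uv2] [t0 vwE vw1 vw2]; split.
- exact: addr_ge0.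
- by rewrite vwE uvE geodesic_flowD.
- move=> r /andP[r0 rst]; have [rs|sr] := leP r s.
    have [|z /andP[uz zv] zE] := uv1 r; first by rewrite r0.
    by exists z => //; rewrite uz (le_trans zv).
  have [|z /andP[vz zw] zE] := vw1 (r - s); first by apply/andP; split; lra.
  exists z; first by rewrite zw (le_trans uv).
  by rewrite zE uvE geodesic_flowD subrKC.
- move=> z /andP[uz zw]; have [zv|vz] := leP z v.
    have [|r /andP[r0 rs] rE] := uv2 z; first by rewrite uz.
    by exists r => //; rewrite r0 (le_trans rs)// lerDl.
  have [|r /andP[r0 rt] rE] := vw2 z; first by rewrite ltW.
  exists (s + r); first by apply/andP; split; lra.
  by rewrite rE uvE geodesic_flowD.
Qed.

(** Near a given time, increments of the increasing [alpha] serve as [tau], and the intermediate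
    value theorem fills the arc. Durations add up over consecutive arcs. *)
Lemma ex_orbit_arc x u v : u <= v -> exists tau, orbit_arc x u v tau.
Proof.
move=> uv; apply: (@cousin _ (fun u v => exists tau, orbit_arc x u v tau)) => //.
  move=> a b c _ ab bc _ [s sP] [t tP]; exists (s + t).
  exact: (orbit_arc_trans ab bc).
move=> t _; have [e [al [e0 al0 cal hal [alE _]]]] := orbit_line_local hP x t.
exists e => // a b ea at_ tb be _ _.
have inE w : a <= w -> w <= b -> w - t \in `]-e, e[.
  by move=> aw wb; rewrite in_itv/=; apply/andP; split; lra.
have alw w : a <= w -> w <= b -> Phi x w = g (al (w - t) - al (a - t)) (Phi x a).
  move=> aw wb; have ab : a <= b by lra.
  have := alE _ (inE _ aw wb); have := alE _ (inE _ (lexx a) ab).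
  by rewrite !(addrC t) !subrK => -> ->; rewrite geodesic_flowD subrKC.
have mono w w' : a <= w -> w <= w' -> w' <= b -> al (w - t) <= al (w' - t).
  move=> aw ww' w'b; move: (ww'); rewrite le_eqVlt => /predU1P[->//|lt].
  by apply/ltW/hal; rewrite ?inE ?ltrD2r//; lra.
have ab : a <= b by lra.
exists (al (b - t) - al (a - t)); split.
- by rewrite subr_ge0 mono.
- exact: alw.
- move=> s /andP[s0 sb].
  have abt : a - t <= b - t by lra.
  have cf : {within `[a - t, b - t], continuous al}.
    apply: continuous_subspaceW cal => w /=; rewrite !in_itv/= => /andP[? ?].
    by apply/andP; split; lra.
  have [|w] := @IVT _ al _ _ (al (a - t) + s) abt cf.
    rewrite ge_min le_max; apply/andP; split; apply/orP; [left|right]; lra.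
  rewrite in_itv/= => /andP[aw wb] alws; exists (w + t); first by apply/andP; split; lra.
  by rewrite alw; [rewrite addrK alws addrAC subrr add0r|lra..].
- move=> w /andP[aw wb]; exists (al (w - t) - al (a - t)); last exact: alw.
  by rewrite subr_ge0 mono// lerD2r mono.
Qed.

Lemma orbit_arc_shift x (n : int) u v tau :
  orbit_arc (sft_power n x) u v tau -> orbit_arc x (u + n%:~R) (v + n%:~R) tau.
Proof.
rewrite /orbit_arc -!orbit_line_shift => -[t0 vE uv1 uv2]; split=> //.
- move=> s /uv1[w /andP[uw wv] wE]; exists (w + n%:~R); first by rewrite !lerD2r uw.
  by rewrite orbit_line_shift.
- move=> w /andP[uw wv]; have [|s s0 sE] := uv2 (w - n%:~R).
    by apply/andP; split; lra.
  by exists s => //; rewrite -sE -orbit_line_shift subrK.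
Qed.

Variable r : R.
Hypothesis rP : CAT0_radius X r.

(** Below the scale [r] the duration is determined by the ends of the arc, which removes the choice
    of [tau]. *)
Lemma orbit_arc_length x u v tau : orbit_arc x u v tau -> tau < r ->
  tau = mdist (Phi x v 0) (Phi x u 0).
Proof.
move=> [tau0 -> _ _] taur /=; rewrite add0r.
rewrite (CAT0_radius_isometric rP (lineP (Phi x u))) ?subr0 ger0_norm//.
Qed.

(** A longer arc contains a moment at which the geodesic has advanced by exactly [r / 16], which
    uniform continuity excludes over a short suspension time. *)
Lemma short_orbit_arc : exists N : nat, forall x u v tau, 0 <= u -> u <= v -> v <= 1 ->
  v - u <= N.+1%:R^-1 -> orbit_arc x u v tau -> tau <= r / 8.
Proof.
have [r0 _] := rP; have r16 : 0 < r / 16 by rewrite divr_gt0.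
have [N NP] := orbit_line_unif p_cover cX gX hP 0 r16.
exists N => x u v tau u0 uv v1 uvN [tau0 _ arc1 _]; rewrite leNgt; apply/negP => tau_gt.
have [|w /andP[uw wv] wE] := arc1 (r / 16); first by apply/andP; split; lra.
have xx : agree N (val x) (val x) by [].
have uwN : `|u - w| <= N.+1%:R^-1 by rewrite distrC ger0_norm ?subr_ge0// (le_trans _ uvN)// lerD2r.
have := NP x x u w xx; rewrite u0 (le_trans uv v1) (le_trans wv v1) (le_trans u0 uw).
move=> /(_ isT isT uwN 0); rewrite normr0 lexx => /(_ isT).
rewrite wE /= add0r metric_sym (CAT0_radius_isometric rP (lineP (Phi x u))).
  by rewrite subr0 ger0_norm ?ltW// ltxx.
by rewrite subr0 ger0_norm ?ltW//; lra.
Qed.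

End time_change.

Arguments orbit_arc {R Xt X p A W} h x u v tau.

(** * Geodesic time elapsed along symbolic orbits *)

Section orbit_time.
Context {R : realType} {Xt X : metricType R} {p : Xt -> X} {A : finType}
  {W : seq (seq A)} {h : Susp R W -> GX p}.
Hypotheses (p_cover : universal_cover p) (cX : compact [set: X])
  (gX : geodesic_space X)
  (hP : orbit_semi_equivalence (susp_flow R W) (geodesic_flow p) h).
Implicit Types (x y : sft W).
Variables (r : R) (q : nat).
Hypotheses (rP : CAT0_radius X r) (q0 : (0 < q)%N)
  (short : forall x u v tau, 0 <= u -> u <= v -> v <= 1 -> v - u <= q%:R^-1 ->
     orbit_arc h x u v tau -> tau <= r / 8).

Local Notation g := (geodesic_flow p).
Local Notation Phi := (orbit_line h).

(** A unit of suspension time is cut into [q] ticks so that each takes at most [r / 8], the step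
    allowed by [CAT0_drift]. *)
Definition tick (j : nat) : R := j%:R / q%:R.

(* Consecutive ticks being short, this distance along a local geodesic is the
   time elapsed in the geodesic flow. *)
Definition orbit_step x (j : nat) : R :=
  mdist (Phi x (tick j.+1) 0) (Phi x (tick j) 0).

Definition orbit_time x (n : nat) : R := \sum_(0 <= j < n) orbit_step x j.

Let qR0 : 0 < q%:R :> R. Proof. by rewrite ltr0n. Qed.

Lemma tick0 : tick 0 = 0. Proof. by rewrite /tick mul0r. Qed.

Lemma tickD m n : tick (m + n) = tick m + tick n.
Proof. by rewrite /tick natrD mulrDl. Qed.

Lemma tick_mul k : tick (k * q) = k%:R.
Proof. by rewrite /tick natrM mulfK// gt_eqF. Qed.

Lemma tick_unit : tick q = 1.
Proof. by rewrite /tick divff// gt_eqF. Qed.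

Lemma tick_le m n : (m <= n)%N -> tick m <= tick n.
Proof. by move=> mn; rewrite /tick ler_pM2r ?invr_gt0// ler_nat. Qed.

Lemma orbit_line_tick x (k j : nat) :
  Phi x (tick (k * q + j)) = Phi (sft_power k x) (tick j).
Proof. by rewrite -orbit_line_shift tickD tick_mul addrC. Qed.

Lemma orbit_arc_step x j : orbit_arc h x (tick j) (tick j.+1) (orbit_step x j) /\
  orbit_step x j <= r / 8.
Proof.
have [r0 _] := rP.
pose k := (j %/ q)%N; pose i := (j %% q)%N; have iq : (i < q)%N by rewrite ltn_mod.
have jE : j = (k * q + i)%N by exact: divn_eq.
have le_i : tick i <= tick i.+1 by exact: tick_le.
have [tau tauP] := ex_orbit_arc hP (sft_power k x) le_i.
have tick1 : tick i.+1 <= 1 by rewrite -tick_unit tick_le.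
have tickV : tick i.+1 - tick i <= q%:R^-1.
  by rewrite /tick -mulrBl -natrB// subSnn mul1r.
have taur : tau <= r / 8.
  by apply: (short _ le_i tick1 tickV tauP); rewrite -tick0 tick_le.
have := orbit_arc_shift tauP; rewrite -[(k%:Z)%:~R]/(k%:R) -(tick_mul k).
rewrite -!tickD !(addnC _ (k * q)%N) addnS -jE => {}tauP.
have := orbit_arc_length rP tauP; rewrite -/(orbit_step x j) => <- //.
by move: r0 taur; lra.
Qed.

Lemma orbit_arc_time x n : orbit_arc h x 0 (tick n) (orbit_time x n).
Proof.
elim: n => [|n IH].
  rewrite tick0 /orbit_time big_geq//; split.
  - by [].
  - by rewrite geodesic_flow0.
  - move=> s; rewrite andbC => /le_anti ->; exists 0; first by rewrite lexx.
    by rewrite geodesic_flow0.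
  - move=> s; rewrite andbC => /le_anti ->; exists 0; first by rewrite lexx.
    by rewrite geodesic_flow0.
rewrite /orbit_time big_nat_recr//=; apply: orbit_arc_trans IH (orbit_arc_step x n).1.
  by rewrite -tick0 tick_le.
exact: tick_le.
Qed.

Lemma orbit_line_time x n : Phi x (tick n) = g (orbit_time x n) (Phi x 0).
Proof. by case: (orbit_arc_time x n). Qed.

Lemma orbit_step_itv x j : 0 <= orbit_step x j <= r / 8.
Proof. by rewrite mdist_ge0; have [] := orbit_arc_step x j. Qed.

Lemma orbit_time0 x : orbit_time x 0 = 0. Proof. exact: big_geq. Qed.

Lemma orbit_timeS x n : orbit_time x n.+1 = orbit_time x n + orbit_step x n.
Proof. by rewrite /orbit_time big_nat_recr. Qed.

(** The cocycle relation of the time change over the shift. *)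
Lemma orbit_timeD x k n :
  orbit_time x (k * q + n) = orbit_time x (k * q) + orbit_time (sft_power k x) n.
Proof.
elim: n => [|n IH]; first by rewrite addn0 orbit_time0 addr0.
rewrite addnS !orbit_timeS IH addrA; congr (_ + _).
by rewrite /orbit_step -addnS !orbit_line_tick.
Qed.

Lemma orbit_time_le x m n : (m <= n)%N -> orbit_time x m <= orbit_time x n.
Proof.
move=> mn; rewrite -(subnKC mn); elim: (n - m)%N => [|k IH]; first by rewrite addn0.
rewrite addnS orbit_timeS (le_trans IH)// lerDl.
by case/andP: (orbit_step_itv x (m + k)).
Qed.

Lemma orbit_time_upper x n : orbit_time x n <= n%:R * (r / 8).
Proof.
elim: n => [|n IH]; first by rewrite orbit_time0 mul0r.
rewrite orbit_timeS -natr1 mulrDl mul1r lerD//.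
by case/andP: (orbit_step_itv x n).
Qed.

Lemma orbit_time_units (k : R) x n : (forall y, k <= orbit_time y q) ->
  n%:R * k <= orbit_time x (n * q).
Proof.
move=> kP; elim: n => [|n IH]; first by rewrite mul0n mul0r orbit_time0.
by rewrite mulSnr orbit_timeD -natr1 mulrDl mul1r lerD.
Qed.

Lemma orbit_line_time_surj (c : GX p) : exists x s,
  0 <= s <= orbit_time x q /\ c = g s (Phi x 0).
Proof.
have [x [t [t01 ->]]] := orbit_line_surj hP c.
have [_ _ _] := orbit_arc_time x q; rewrite tick_unit.
by move=> /(_ t t01)[s s0 sE]; exists x, s.
Qed.

Lemma orbit_time_lower : exists2 k : R, 0 < k & forall x, k <= orbit_time x q.
Proof.
have : \forall n \near \oo, [set: (sft W : Type)] `<=`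
    [set x | n.+1%:R^-1 <= orbit_time x q].
  have /compact_near_coveringP := compact_set_type (@compact_sft A W).
  apply => x _.
  have [e [al [e0 _ _ _ [_ inj]]]] := orbit_line_local hP x 0.
  pose w := Num.min (e / 2) 1; have w0 : 0 < w by rewrite lt_min ltr01 divr_gt0.
  have we : w <= e / 2 by rewrite ge_min lexx.
  have w1 : w <= 1 by rewrite ge_min lexx orbT.
  have [v] : exists v, Phi x w v <> Phi x 0 v.
    apply: contrapT => /forallNP same; suff : w = 0 by move: w0; lra.
    apply: inj; rewrite ?in_itv/=; try by apply/andP; split; lra.
    by rewrite !add0r; apply: eq_line => v; apply: contrapT; exact: same.
  move/eqP; rewrite -mdist_gt0 => d0; set d := mdist _ _ in d0.
  have d4 : 0 < d / 4 by rewrite divr_gt0.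
  have cont (s : R) (s01 : `[0, 1]%classic s) :
      nbhs x [set y | mdist (Phi x s v) (Phi y s v) < d / 4].
    pose F y : GX p := h (susp_point y s01).
    have cF : continuous F.
      move=> y; apply: (@continuous_comp _ (Susp R W) _ (fun y => susp_point y s01) h);
        last by case: hP => + _ _; apply.
      apply: (@continuous_comp _ (@susp_domain R A W) (Susp R W)
        (fun y => (y, exist _ s (mem_set s01)))); last exact: pi_continuous.
      apply: (@pair_continuous _ _ _ id (fun=> _)) => z; first exact: cvg_id.
      exact: cst_continuous.
    have nF : nbhs x [set y | line_close `|v| (d / 4) (F x) (F y)].
      exact: cF x _ (nbhs_close (F x) `|v| p_cover cX gX d4).
    apply: filterS nF => y /= /(_ v (lexx _)).
    by rewrite /F /orbit_line !(susp_orbit_itv _ s01).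
  have w01 : `[0, 1]%classic w by rewrite /= in_itv/= w1 ltW.
  exists ([set y | mdist (Phi x w v) (Phi y w v) < d / 4 /\
      mdist (Phi x 0 v) (Phi y 0 v) < d / 4], [set n | n.+1%:R^-1 < d / 4]) => /=.
    split; last first.
      exact: (near_infty_natSinv_lt (PosNum d4)).
    by apply: filterI; [exact: (cont w w01)|exact: (cont 0 itv01_0)].
  move=> [y n] /= [[yw y0] nd].
  have [_ _ _] := orbit_arc_time y q; rewrite tick_unit.
  move=> /(_ w)[|s /andP[s0 sT] sE]; first by rewrite w1 ltW.
  apply: le_trans (ltW nd) _; apply: le_trans _ sT.
  have := locally_isometric_lipschitz (lineP (Phi y 0)) (v + s) v.
  rewrite addrAC subrr add0r (ger0_norm s0) => ds.
  have := mdist_lipschitz (Phi x w v) (Phi x 0 v) (Phi y w v) (Phi y 0 v).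
  rewrite -/d ler_norml => /andP[_]; rewrite [in X in _ - mdist X _]sE /=.
  by move: yw y0 ds; lra.
move=> [n _ /(_ n (leqnn n)) nP]; exists n.+1%:R^-1; first by rewrite invr_gt0.
by move=> x; exact: nP.
Qed.

Lemma orbit_close (K e : R) : 0 < e -> exists N : nat, forall x y (n : nat),
  (forall k : int, - N%:Z <= k <= n%:Z + N%:Z -> val x k = val y k) ->
  forall j, (j <= n * q)%N -> line_close K e (Phi x (tick j)) (Phi y (tick j)).
Proof.
move=> e0; have [N NP] := orbit_line_unif p_cover cX gX hP K e0.
exists N => x y n xy j jn; pose k := (j %/ q)%N; pose i := (j %% q)%N.
have jE : j = (k * q + i)%N by exact: divn_eq.
have iq : (i < q)%N by rewrite ltn_mod.
have kn : (k <= n)%N by rewrite -(mulnK n q0) leq_div2r.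
rewrite jE !orbit_line_tick; apply: NP.
- by move=> m /andP[m1 m2] /=; rewrite /Defs.shift; apply: xy; lia.
- by rewrite -tick0 tick_le//= -tick_unit tick_le// ltnW.
- by rewrite -tick0 tick_le//= -tick_unit tick_le// ltnW.
- by rewrite subrr normr0 invr_ge0.
Qed.

End orbit_time.

Arguments orbit_step {R Xt X p A W} h q x j.
Arguments orbit_time {R Xt X p A W} h q x n.

(** * Words of a subshift of finite type *)

Section sft_blocks.
Context {A : finType} (W : seq (seq A)).
Implicit Types (x y : sft W).

(** Blocks of this length act as the vertices of a graph presenting the subshift. *)
Definition memory := \max_(w <- W) size w.

Definition block_type : finType := {ffun 'I_memory -> A}.

Definition block (x : int -> A) (n : int) : block_type :=
  [ffun i : 'I_memory => x (n + i%:Z)].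

Lemma blockP (x y : int -> A) (i j : int) :
  block x i = block y j <->
  forall t : nat, (t < memory)%N -> x (i + t%:Z) = y (j + t%:Z).
Proof.
split=> [/ffunP xy t tm|xy]; first by have := xy (Ordinal tm); rewrite !ffunE.
by apply/ffunP => t; rewrite !ffunE xy.
Qed.

Definition splice (x : int -> A) (i : int) (y : int -> A) (j : int) : full_shift A :=
  fun k => if k < i then x k else y (k - i + j).

Lemma splice_left (x y : int -> A) i j k : block x i = block y j ->
  k < i + memory%:Z -> splice x i y j k = x k.
Proof.
move=> /blockP xy km; rewrite /splice; case: ltP => // ik.
have -> : k = i + `|k - i|%N%:Z by lia.
by rewrite xy; [congr y; lia|lia].
Qed.

Lemma splice_right (x y : int -> A) i j k : i <= k ->
  splice x i y j k = y (k - i + j).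
Proof. by rewrite /splice; case: ltP. Qed.

(** A forbidden word is no longer than the common block, so a window of its size that starts before
    [i] is read entirely in [x], and any other one in [y]. *)
Lemma sft_splice x y i j : block (val x) i = block (val y) j ->
  sft W (splice (val x) i (val y) j).
Proof.
move=> xy w n wW; have wm : (size w <= memory)%N by exact: leq_bigmax_seq.
have [ni|i_n] := ltP n i.
  rewrite (_ : subword _ _ _ = subword (val x) n (size w)).
    exact: (set_valP x).
  apply/eq_in_map => t; rewrite mem_iota add0n => /andP[_ tw].
  by apply: splice_left => //; lia.
rewrite (_ : subword _ _ _ = subword (val y) (n - i + j) (size w)).
  exact: (set_valP y).
apply/eq_in_map => t _; rewrite splice_right; last by lia.
by congr (val y _); lia.
Qed.

Definition sft_cat x y i j (xy : block (val x) i = block (val y) j) : sft W :=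
  exist (fun z => z \in sft W) _ (mem_set (sft_splice xy)).

(** Equal positions are allowed, but a block reaches itself only if it occurs in the subshift. *)
Definition reach (u v : block_type) : bool :=
  `[< exists x (i j : int), [/\ i <= j, block (val x) i = u & block (val x) j = v] >].

Lemma reach_block x i j : i <= j -> reach (block (val x) i) (block (val x) j).
Proof. by move=> ij; apply/asboolP; exists x, i, j. Qed.

Lemma reach_trans : transitive reach.
Proof.
move=> v u w /asboolP[x [i [j [ij <- xj]]]] /asboolP[y [i' [j' [ij' yi' <-]]]].
rewrite -xj in yi'; have xy := esym yi'.
pose z : sft W := sft_cat xy.
have -> : block (val x) i = block (val z) i.
  by apply/blockP => t tm; rewrite /= splice_left//; lia.
have -> : block (val y) j' = block (val z) (j + (j' - i')).
  by apply/blockP => t tm; rewrite /= splice_right; [congr (val y _); lia|lia].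
by apply: reach_block; lia.
Qed.

Definition same_class u v := reach u v && reach v u.

Lemma reach_bounded : exists M : nat, forall u v, reach u v ->
  exists x (i : int) (n : nat),
    [/\ (n <= M)%N, block (val x) i = u & block (val x) (i + n%:Z) = v].
Proof.
have /choice[f fP] : forall uv : block_type * block_type, exists n : nat,
    reach uv.1 uv.2 -> exists x (i : int),
      block (val x) i = uv.1 /\ block (val x) (i + n%:Z) = uv.2.
  move=> [u v] /=; have [/asboolP[x [i [j [ij xi xj]]]]|] := boolP (reach u v); last by exists 0%N.
  exists `|j - i|%N => _; exists x, i; split=> //.
  by rewrite -xj; congr (block _ _); lia.
exists (\max_uv f uv) => u v /(fP (u, v))[x [i [xi xj]]].
by exists x, i, (f (u, v)); split=> //; exact: leq_bigmax.
Qed.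

(** It never increases along a sequence, and equal ranks at two positions force a return from the
    later block to the earlier one. *)
Definition rank (u : block_type) := #|reach u|.

Lemma rank_reach u v : reach u v -> (rank v <= rank u)%N.
Proof.
move=> uv; apply: subset_leq_card; apply/fintype.subsetP => w; rewrite !unfold_in.
exact: reach_trans.
Qed.

Lemma rank_block x i j : i <= j ->
  (rank (block (val x) j) <= rank (block (val x) i))%N.
Proof. by move=> ij; apply/rank_reach/reach_block. Qed.

Lemma rank_eq_reach x i k : i <= k ->
  rank (block (val x) i) = rank (block (val x) k) ->
  reach (block (val x) k) (block (val x) i).
Proof.
move=> ik rk; have sub : reach (block (val x) k) \subset reach (block (val x) i).
  by apply/fintype.subsetP => w; rewrite !unfold_in; apply: reach_trans; exact: reach_block.
have /subset_cardP/(_ sub)/(_ (block (val x) i)) E := esym rk.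
have : block (val x) i \in reach (block (val x) i) by exact: reach_block.
by rewrite -E.
Qed.

(** Each word is copied with a margin of [N] letters on either side, as shadowing demands.
    Connecting words are bounded because there are finitely many pairs of blocks. *)
Lemma sft_concat (u : block_type) (N : nat) : exists M : nat,
  forall (xs : nat -> sft W) (n : nat -> nat) (k : nat),
  (forall j i, same_class u (block (val (xs j)) i)) ->
  exists y (pos : nat -> nat),
    (forall j, (j < k)%N -> exists2 gap, (gap <= M)%N & pos j.+1 = (pos j + n j + gap)%N) /\
    forall j, (j <= k)%N -> forall t : int, - N%:Z <= t <= (n j)%:Z + N%:Z ->
      val y ((pos j)%:Z + t) = val (xs j) t.
Proof.
have [M MP] := reach_bounded; exists (2 * N + 1 + M)%N => xs n k cl.
(* The induction lets [y] follow the last sequence forever, so that a whole block is available for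
   splicing beyond the last word. *)
suff : exists y (pos : nat -> nat), [/\
    (forall j, (j < k)%N -> exists2 gap, (gap <= 2 * N + 1 + M)%N & pos j.+1 = (pos j + n j + gap)%N),
    (forall j, (j <= k)%N -> forall t : int, - N%:Z <= t <= (n j)%:Z + N%:Z ->
      val y ((pos j)%:Z + t) = val (xs j) t),
    (forall j, (j <= k)%N -> (pos j + n j <= pos k + n k)%N) &
    forall t : int, - N%:Z <= t -> val y ((pos k)%:Z + t) = val (xs k) t].
  by move=> [y [pos [h1 h2 _ _]]]; exists y, pos.
elim: k => [|k [y [pos [gapP wordP posP tailP]]]].
  exists (xs 0%N), (fun=> 0%N); split=> //.
  - by move=> j; rewrite leqn0 => /eqP -> t _; rewrite add0r.
  - by move=> j; rewrite leqn0 => /eqP ->.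
  - by move=> t _; rewrite add0r.
pose e : int := (n k)%:Z + N%:Z + 1.
have rch : reach (block (val (xs k)) e) (block (val (xs k.+1)) (- N%:Z)).
  have /andP[_ r1] := cl k e; have /andP[r2 _] := cl k.+1 (- N%:Z).
  exact: reach_trans r1 r2.
have [z [a [b [bM za zb]]]] := MP _ _ rch.
pose c : int := (pos k)%:Z + e.
have yz : block (val y) c = block (val z) a.
  rewrite za; apply/blockP => t tm; rewrite -tailP; last by rewrite /e; lia.
  by congr (val y _); rewrite /c; lia.
pose y1 : sft W := sft_cat yz.
have y1x : block (val y1) (c + b%:Z) = block (val (xs k.+1)) (- N%:Z).
  rewrite -zb; apply/blockP => t tm; rewrite /= splice_right; last by lia.
  by congr (val z _); lia.
pose y2 : sft W := sft_cat y1x.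
(* The gap counts the right margin and one letter, the connecting word, and the left margin of the
   next word. *)
pose gap := (2 * N + 1 + b)%N; pose pk := (pos k + n k + gap)%N.
pose pos2 j := if (j <= k)%N then pos j else pk.
have pos2k : pos2 k.+1 = pk by rewrite /pos2 ltnn.
have y2y t : t < c -> val y2 t = val y t.
  by move=> tc; rewrite /= splice_left// ?splice_left//; lia.
have tail2 (t : int) : - N%:Z <= t -> val y2 (pk%:Z + t) = val (xs k.+1) t.
  move=> tN; rewrite /= splice_right; last by rewrite /c /pk /gap /e; lia.
  by congr (val _ _); rewrite /c /pk /gap /e; lia.
exists y2, pos2; split.
- move=> j; rewrite ltnS leq_eqVlt => /predU1P[->|jk].
    by exists gap; rewrite ?pos2k /pos2 ?leqnn//= /gap leq_add2l.
  have [gp gpM gpE] := gapP j jk; exists gp => //.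
  by rewrite /pos2 jk (ltnW jk).
- move=> j; rewrite leq_eqVlt => /predU1P[->|].
    by rewrite pos2k => t /andP[tN _]; exact: tail2.
  rewrite ltnS => jk t tN; rewrite /pos2 jk y2y; first exact: wordP.
  by have := posP j jk; rewrite /c /e; lia.
- move=> j; rewrite leq_eqVlt => /predU1P[-> //|].
  rewrite ltnS pos2k => jk; rewrite /pos2 jk; have := posP j jk.
  by rewrite /pk; lia.
- by rewrite pos2k.
Qed.

End sft_blocks.

(** * Transitivity *)

Section flow.
Context {R : realType} {Xt X : metricType R} {p : Xt -> X}.
Hypotheses (p_cover : universal_cover p) (cX : compact [set: X])
  (gX : geodesic_space X).

Local Notation g := (geodesic_flow p).

Lemma open_geodesic_flow (t : R) (U : set (GX p)) : open U -> open (g t @^-1` U).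
Proof.
move=> oU; suff : dist_open (g t @^-1` U : set (dist_topology (dGX p))) by [].
move=> c Uc; have [d d0 dU] := oU _ Uc.
have [K [e [K0 e0 KeP]]] := close_dGX p_cover cX gX d0.
have [d' d'0 d'P] := dGX_close p_cover cX gX (K + `|t|) e0.
exists d' => // c' /d'P cl; apply/dU/KeP => s sK /=; apply: cl.
by rewrite (le_trans (ler_normD _ _))// lerD2r.
Qed.

(** Induction on open sets of geodesics with a prescribed itinerary. As transitivity yields only a
    nonnegative time, it is applied to the set already moved forward by [tau n + G]. *)
Lemma transitive_visits (V : nat -> set (GX p)) (G : R) (n : nat) : 0 <= G ->
  topologically_transitive g ->
  (forall i, open (V i)) -> (forall i, V i !=set0) ->
  exists (c : GX p) (tau : nat -> R), [/\ 0 <= tau 0%N,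
    forall i, (i < n)%N -> tau i + G <= tau i.+1 &
    forall i, (i <= n)%N -> V i (g (tau i) c)].
Proof.
move=> G0 trans oV V0.
suff : exists (U : set (GX p)) (tau : nat -> R), [/\ open U, U !=set0, 0 <= tau 0%N,
    forall i, (i < n)%N -> tau i + G <= tau i.+1 &
    forall c, U c -> forall i, (i <= n)%N -> V i (g (tau i) c)].
  by move=> [U [tau [_ [c Uc] t0 gap UV]]]; exists c, tau; split=> // i; exact: UV.
elim: n => [|n [U [tau [oU U0 t0 gap UV]]]].
  exists (V 0%N), (fun=> 0); split=> // c Vc i; rewrite leqn0 => /eqP ->.
  by rewrite geodesic_flow0.
have oU' := @open_geodesic_flow (- (tau n + G)) U oU.
have U'0 : g (- (tau n + G)) @^-1` U !=set0.
  case: U0 => c Uc; exists (g (tau n + G) c) => /=.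
  by rewrite geodesic_flowD subrr geodesic_flow0.
have [s s0 [_ [[c /= Uc <-] Vc]]] := trans _ _ oU' (oV n.+1) U'0 (V0 n.+1).
pose T := tau n + G + s; pose tau' i := if (i <= n)%N then tau i else T.
exists (U `&` g T @^-1` V n.+1), tau'; split.
- by apply: openI => //; exact: open_geodesic_flow.
- exists (g (- (tau n + G)) c); split=> //=.
  by rewrite geodesic_flowD /T addrA addNr add0r.
- by rewrite /tau'.
- move=> i; rewrite ltnS leq_eqVlt /tau' => /predU1P[->|i_n].
    by rewrite leqnn ltnn /T lerDl.
  by rewrite i_n (ltnW i_n) gap.
- move=> c' [Uc' Vc'] i; rewrite leq_eqVlt /tau' => /predU1P[->|].
    by rewrite ltnn.
  by rewrite ltnS => i_n; rewrite i_n; exact: UV.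
Qed.

End flow.

(** * One communicating class covers the flow *)

Section transitive_class.
Context {R : realType} {Xt X : metricType R} {p : Xt -> X} {A : finType}
  {W : seq (seq A)} {h : Susp R W -> GX p}.
Hypotheses (p_cover : universal_cover p) (cX : compact [set: X])
  (gX : geodesic_space X)
  (hP : orbit_semi_equivalence (susp_flow R W) (geodesic_flow p) h)
  (trans : topologically_transitive (geodesic_flow p)).
Implicit Types (x y : sft W).
Variables (r : R) (q : nat).
Hypotheses (rP : CAT0_radius X r) (q0 : (0 < q)%N)
  (short : forall x u v tau, 0 <= u -> u <= v -> v <= 1 -> v - u <= q%:R^-1 ->
     orbit_arc h x u v tau -> tau <= r / 8).

Local Notation g := (geodesic_flow p).
Local Notation Phi := (orbit_line h).
Local Notation S := (block_type W).

Definition in_class (u : S) x := forall k : int, same_class u (block W (val x) k).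

(** Each point of the domain either shows a block outside the class in a finite window, or has an
    image that differs from [c] at some time; both persist nearby. By compactness a single [n]
    serves as window of coordinates, time window and inverse accuracy. *)
Lemma avoid_class (u : S) (c : GX p) :
  (forall x s, in_class u x -> 0 <= s <= 1 -> c <> Phi x s) ->
  exists (V : set (GX p)) (n : nat), [/\ open V, V c &
    forall x s, 0 <= s <= 1 -> V (Phi x s) ->
      exists2 k : int, - n%:Z <= k <= n%:Z & ~~ same_class u (block W (val x) k)].
Proof.
move=> cP; pose D := (@susp_domain R A W).
pose F (a : D) : GX p := h (\pi_(Susp R W) a).
have cF : continuous F.
  by move=> a; apply: continuous_comp; [exact: pi_continuous|case: hP => + _ _; apply].
pose P (n : nat) (a : D) := line_close n%:R n.+1%:R^-1 c (F a) ->
  exists2 k : int, - n%:Z <= k <= n%:Z & ~~ same_class u (block W (val a.1) k).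
have : \forall n \near \oo, [set: D] `<=` P n.
  move/compact_near_coveringP: (@compact_susp_domain R A W); apply => a _.
  have [[k kP]|inu] := pselect (exists k, ~~ same_class u (block W (val a.1) k)).
    have val_cont : continuous (fun c : D => val c.1).
      move=> b; apply: (@continuous_comp D (sft W : Type) (full_shift A) fst set_val).
        exact: cvg_fst.
      exact: initial_continuous.
    exists ([set b : D | forall j, j \in [seq k + t%:Z | t <- iota 0 (memory W)] ->
        val b.1 j = val a.1 j], [set n | (`|k|%N <= n)%N]) => /=.
      split; last by exists `|k|%N.
      exact: val_cont a _ (near_coordinates _ _).
    move=> [b n] /= [bP kn] _; exists k; first by lia.
    rewrite (_ : block W _ k = block W (val a.1) k)//.
    apply/blockP => t tm; apply: bP; apply: map_f.
    by rewrite mem_iota.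
  have cF' : c <> F a.
    case: a inu => x [s s01] inu.
    have -> : F (x, exist _ s s01) = Phi x s.
      rewrite /F /orbit_line (susp_orbit_itv x (set_mem s01)) /susp_point.
      by congr (h (\pi_(Susp R W) (_, _))); exact: val_inj.
    apply: cP; last by have := set_mem s01; rewrite /= in_itv.
    by move=> k; apply: contrapT => /negP uk; apply: inu; exists k.
  have [v /eqP] : exists v, c v <> F a v.
    by apply: contrapT => /forallNP same; apply: cF'; apply: eq_line => v;
      apply: contrapT; exact: same.
  rewrite -mdist_gt0 => d0; set d := mdist _ _ in d0.
  have d2 : 0 < d / 2 by rewrite divr_gt0.
  have nF : nbhs a [set b : D | line_close `|v| (d / 2) (F a) (F b)].
    exact: cF a _ (nbhs_close (F a) `|v| p_cover cX gX d2).
  exists ([set b : D | mdist (F a v) (F b v) < d / 2],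
      [set n | n.+1%:R^-1 < d / 2 /\ `|v| <= n%:R]) => /=.
    split; first by apply: filterS nF => b /= /(_ v (lexx _)).
    apply: filterI; first exact: (near_infty_natSinv_lt (PosNum d2)).
    exact: nbhs_infty_ger.
  move=> [b n] /= [bv [nd vn]] /(_ v vn) cv; exfalso.
  have := metric_triangle (c v) (F b v) (F a v); rewrite -/d.
  rewrite (metric_sym (F b v)) leNgt => /negP; apply.
  by rewrite (splitr d) ltrD// (lt_trans cv).
move=> [n _ /(_ n (leqnn n)) nP].
have n0 : 0 < n.+1%:R^-1 :> R by rewrite invr_gt0.
exists ([set c' : GX p | line_close n%:R n.+1%:R^-1 c c']^°), n; split.
- exact: open_interior.
- exact: nbhs_close.
- move=> x s s01 /interior_subset cl.
  have s01' : `[0, 1]%classic s by rewrite /= in_itv.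
  have := nP (x, exist _ s (mem_set s01')) I; apply.
  by move: cl; rewrite /= /orbit_line (susp_orbit_itv x s01').
Qed.

(* Visiting all the sets [V u] of [avoid_class] cyclically, an orbit would leave
   its class, hence decrease its rank, in each cycle. *)
Lemma transitive_one_class : GX p -> exists u : S, forall c : GX p,
  exists x s, [/\ in_class u x, 0 <= s <= 1 & c = Phi x s].
Proof.
move=> c0; apply: contrapT => /forallNP none.
have /choice[V /choice[n Vn]] : forall u : S, exists V : set (GX p), exists n : nat,
    [/\ open V, V !=set0 & forall x s, 0 <= s <= 1 -> V (Phi x s) ->
      exists2 k : int, - n%:Z <= k <= n%:Z & ~~ same_class u (block W (val x) k)].
  move=> u; have /existsNP[c cP] := none u.
  have [|V [n [oV Vc VP]]] := @avoid_class u c.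
    by move=> x s ux s01 cE; apply: cP; exists x, s.
  by exists V, n; split=> //; exists c.
have [k k0 kP] := orbit_time_lower p_cover cX gX hP rP q0 short.
(* A unit takes at most [q%:R * (r / 8)], so visits [G] apart are at least [2 * L + 1] units apart
   and their windows of radius [L] are disjoint. *)
pose L := \max_u n u; pose G := (2 * L + 1)%:R * (q%:R * (r / 8)) + 1.
have [r0 _] := rP.
have G0 : 0 <= (2 * L + 1)%:R * (q%:R * (r / 8)).
  by rewrite !mulr_ge0//; lra.
have [x0 [s0 [s01 _]]] := orbit_line_surj hP c0.
pose u0 := block W (val x0) 0; pose m := #|S|.
have m0 : (0 < m)%N by apply/card_gt0P; exists u0.
pose target i := nth u0 (enum S) (i %% m).
have oV u : open (V u) by have [] := Vn u.
have V0 u : V u !=set0 by have [] := Vn u.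
have G0' : 0 <= G by rewrite addr_ge0.
(* This makes [m.+1] cycles of [m] visits, with a drop in each, while the rank is at most [m]. *)
pose last_visit := (m.+1 * m)%N.
have [c [tau [tau0 gap visit]]] := @transitive_visits _ _ _ _ p_cover cX gX
  (V \o target) G last_visit G0' trans (fun i => oV _) (fun i => V0 _).
have [x [s [/andP[s00 _] cE]]] := orbit_line_time_surj hP rP q0 short c.
have tau_ge0 i : (i <= last_visit)%N -> 0 <= tau i.
  elim: i => // i IH i_n; apply: le_trans (gap i i_n).
  by rewrite addr_ge0// IH// ltnW.
have /choice[pos posP] : forall i, exists j : nat, (i <= last_visit)%N ->
    orbit_time h q x (j * q) <= s + tau i < orbit_time h q x (j.+1 * q).
  move=> i; have [i_n|] := boolP (i <= last_visit)%N; last by exists 0%N.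
  have ex : exists j, s + tau i < orbit_time h q x (j * q).
    exists (Num.truncn ((s + tau i) / k)).+1; apply: lt_le_trans (orbit_time_units q0 _ _ kP).
    by rewrite -ltr_pdivrMr// truncnS_gt.
  case: (ex_minnP ex) => -[|j] jP jmin.
    by move: jP; rewrite mul0n orbit_time0 ltNge addr_ge0// tau_ge0.
  exists j => _; rewrite jP andbT leNgt; apply/negP => /jmin.
  by rewrite ltnn.
have leave i : (i <= last_visit)%N -> exists2 l : int,
    (pos i)%:Z - L%:Z <= l <= (pos i)%:Z + L%:Z &
    ~~ same_class (target i) (block W (val x) l).
  move=> i_n; have /andP[p1 p2] := posP i i_n; have := visit i i_n.
  rewrite cE geodesic_flowD -(subrKC (orbit_time h q x (pos i * q)) (s + tau i)).
  rewrite -geodesic_flowD -(orbit_line_time hP rP q0 short) -[(pos i * q)%N]addn0.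
  rewrite orbit_line_tick// tick0.
  have [_ _ arc1 _] := orbit_arc_time hP rP q0 short (sft_power (pos i) x) q.
  have [|w] := arc1 (s + tau i - orbit_time h q x (pos i * q)).
    rewrite subr_ge0 p1 /= lerBlDl -orbit_timeD//.
    by rewrite -mulSnr ltW.
  rewrite addn0 tick_unit//.
  move=> w01 <- Vw.
  have [_ _ /(_ _ _ w01 Vw)[l lL lP]] := Vn (target i).
  have nL : (n (target i) <= L)%N by exact: leq_bigmax.
  exists ((pos i)%:Z + l); first by clear - lL nL; lia.
  rewrite (_ : block W (val x) _ = block W (val (sft_power (pos i) x)) l)//.
  by apply/blockP => t _ /=; rewrite /Defs.shift; congr (val x _); clear; lia.
have pos_gap i : (i < last_visit)%N -> (pos i + 2 * L + 1 <= pos i.+1)%N.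
  move=> i_n; rewrite leqNgt; apply/negP => lt.
  have /andP[p1 _] := posP i (ltnW i_n); have /andP[_ p2] := posP i.+1 i_n.
  have le : ((pos i.+1).+1 * q <= pos i * q + (2 * L + 1) * q)%N.
    by rewrite -mulnDl leq_mul2r addnA lt orbT.
  have := orbit_time_le hP rP q0 short x le; rewrite orbit_timeD//.
  have := orbit_time_upper hP rP q0 short (sft_power (pos i) x) ((2 * L + 1) * q).
  rewrite natrM -mulrA; have := gap i i_n; rewrite /G.
  by lra.
have pos_mono i j : (i <= j <= last_visit)%N -> (pos i <= pos j)%N.
  move=> /andP[ij]; rewrite -(subnKC ij).
  elim: (j - i)%N => [|l IH]; first by rewrite addn0.
  rewrite addnS => jn.
  by have := pos_gap _ jn; have := IH (ltnW jn); clear; lia.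
pose rk (l : int) := rank (block W (val x) l).
have rk_mono i j : i <= j -> (rk j <= rk i)%N by exact: rank_block.
(* Were the rank constant over the cycle, all its blocks would be in the class of the first one,
   [u]; but the visit to [V u] shows a block outside this class. *)
have drop b : (b < m.+1)%N ->
    (rk ((pos (b * m + m.-1))%:Z + L%:Z)%R < rk ((pos (b * m))%:Z - L%:Z)%R)%N.
  move=> bm; pose l1 : int := (pos (b * m + m.-1)%N)%:Z + L%:Z.
  pose l0 : int := (pos (b * m)%N)%:Z - L%:Z; rewrite -/l1 -/l0.
  have bn : (b * m + m.-1 <= last_visit)%N.
    by rewrite (@leq_trans (b.+1 * m))// ?leq_mul2r ?bm ?orbT// mulSnr leq_add2l leq_pred.
  have b_le : (pos (b * m) <= pos (b * m + m.-1))%N by apply: pos_mono; rewrite leq_addr.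
  have l01 : l0 <= l1 by rewrite /l0 /l1; move: (pos _) (pos _) b_le => a1 a2; clear; lia.
  rewrite ltn_neqAle rk_mono// andbT; apply/eqP => rkE.
  have back := rank_eq_reach l01 (esym rkE).
  pose u := block W (val x) l0; pose a := index u (enum S).
  have am : (a < m)%N by rewrite /m cardE index_mem mem_enum.
  have target_a : target (b * m + a)%N = u.
    by rewrite /target modnMDl modn_small// nth_index ?mem_enum.
  have an : (b * m + a <= b * m + m.-1)%N by rewrite leq_add2l -ltnS prednK.
  have [l /andP[lL1 lL2]] := leave _ (leq_trans an bn); rewrite target_a => /negP; apply.
  have p1 := pos_mono (b * m)%N (b * m + a)%N.
  have p2 := pos_mono (b * m + a)%N (b * m + m.-1)%N.
  have {}p1 := p1 ltac:(by rewrite leq_addr (leq_trans an bn)).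
  have {}p2 := p2 ltac:(by rewrite an bn).
  have l0l : l0 <= l by rewrite /l0; clear - p1 lL1; lia.
  have ll1 : l <= l1 by rewrite /l1; clear - p2 lL2; lia.
  rewrite /same_class reach_block//=; apply: reach_trans back.
  exact: reach_block.
have sum b : (b <= m.+1)%N -> (rk ((pos (b * m))%:Z - L%:Z)%R + b <= rk ((pos 0)%:Z - L%:Z)%R)%N.
  elim: b => [|b IH] bm; first by rewrite addn0.
  have := IH (ltnW bm); have := drop b bm.
  have lt : (b * m + m.-1 < last_visit)%N.
    by rewrite (@leq_trans (b.+1 * m))// ?leq_mul2r ?bm ?orbT// mulSnr -addnS prednK.
  have := pos_gap _ lt; rewrite -addnS prednK// -mulSnr => pg.
  have := @rk_mono ((pos (b * m + m.-1)%N)%:Z + L%:Z) ((pos (b.+1 * m)%N)%:Z - L%:Z).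
  move=> /(_ ltac:(clear - pg; lia)) h3 h2 h1.
  by rewrite addnS; apply: leq_trans h1; rewrite ltn_add2r (leq_ltn_trans h3).
have := sum m.+1 (leqnn _); have : (rk ((pos 0)%:Z - L%:Z)%R <= m)%N by exact: max_card.
by clear; lia.
Qed.

End transitive_class.

(** * Shadowing *)

Section shadowing.
Context {R : realType} {Xt X : metricType R} {p : Xt -> X} {A : finType}
  {W : seq (seq A)} {h : Susp R W -> GX p}.
Hypotheses (p_cover : universal_cover p) (cX : compact [set: X])
  (gX : geodesic_space X)
  (hP : orbit_semi_equivalence (susp_flow R W) (geodesic_flow p) h).
Implicit Types (x y : sft W).
Variables (r : R) (q : nat).
Hypotheses (rP : CAT0_radius X r) (q0 : (0 < q)%N)
  (short : forall x u v tau, 0 <= u -> u <= v -> v <= 1 -> v - u <= q%:R^-1 ->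
     orbit_arc h x u v tau -> tau <= r / 8).

Local Notation g := (geodesic_flow p).
Local Notation Phi := (orbit_line h).
Local Notation time := (orbit_time h q).

Lemma orbit_shadow (d : R) : 0 < d -> exists N : nat, forall x y (n : nat),
  (forall k : int, - N%:Z <= k <= n%:Z + N%:Z -> val y k = val x k) ->
  time x (n * q) <= time y (n * q) + 1 /\ time y (n * q) <= time x (n * q) + 1 /\
  forall u, 0 <= u <= time x (n * q) -> dGX p (g u (Phi y 0)) (g u (Phi x 0)) < d.
Proof.
move=> d0; have [K [e [K0 e0 KeP]]] := close_dGX p_cover cX gX d0.
(* The lag [4 * e1] must be at most 1, the total error [5 * e1] less than [e], and [CAT0_drift] asks
   for [r / 16]. *)
have [r0 _] := rP; pose e1 := Num.min (Num.min (e / 6) (r / 16)) (1 / 4).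
have e10 : 0 < e1 by rewrite !lt_min !divr_gt0.
have e1e : e1 <= e / 6 by rewrite !ge_min lexx.
have e1r : e1 <= r / 16 by rewrite !ge_min lexx orbT.
have e14 : e1 <= 1 / 4 by rewrite !ge_min lexx !orbT.
(* The lag is known at ticks only; the extra [r] covers the step of at most [r / 8] from a tick to
   [u]. *)
have [N NP] := orbit_close p_cover cX gX hP q0 (K + r) e10.
exists N => x y n xy.
have cl j : (j <= n * q)%N -> forall t, `|t| <= K + r ->
    mdist (Phi y 0 (t + time y j)) (Phi x 0 (t + time x j)) < e1.
  move=> jn t tK; have := NP y x n xy j jn t tK.
  by rewrite !(orbit_line_time hP rP q0 short).
have cl0 j : (j <= n * q)%N -> mdist (Phi y 0 (time y j)) (Phi x 0 (time x j)) <= e1.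
  move=> /cl/(_ 0); rewrite normr0 !add0r => /(_ _)/ltW; apply.
  by rewrite addr_ge0// ltW.
have cl0' j : (j <= n * q)%N -> mdist (Phi x 0 (time x j)) (Phi y 0 (time y j)) <= e1.
  by rewrite metric_sym; exact: cl0.
have step z j : 0 <= time z j.+1 - time z j <= r / 8.
  by rewrite orbit_timeS addrAC subrr add0r (orbit_step_itv hP rP q0 short).
have drift j : (j <= n * q)%N -> `|time y j - time x j| <= 4 * e1.
  move=> jn; have sub i : (i <= j)%N -> (i <= n * q)%N by move/leq_trans; apply.
  have := CAT0_drift rP (lineP (Phi x 0)) (lineP (Phi y 0)) e10 e1r
    (fun i ij => cl0 i (sub i ij)) (fun i _ => step x i) (fun i _ => step y i).
  have := CAT0_drift rP (lineP (Phi y 0)) (lineP (Phi x 0)) e10 e1r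
    (fun i ij => cl0' i (sub i ij)) (fun i _ => step y i) (fun i _ => step x i).
  by rewrite !orbit_time0 !subr0 => d1 d2; rewrite ler_norml; apply/andP; split; lra.
have := drift _ (leqnn _); rewrite ler_norml => /andP[dn1 dn2].
split; first by lra.
split; first by lra.
move=> u un; apply: KeP => v vK /=.
have [j jn /andP[ju uj]] : exists2 j, (j <= n * q)%N & time x j <= u <= time x j + r / 8.
  elim: (n * q)%N u un {vK} => [|m IH] u /andP[u0 um].
    by exists 0%N; rewrite // orbit_time0 u0 add0r in um *; lra.
  have [um'|mu] := leP u (time x m).
    have [|j jm ju] := IH u; first by rewrite u0.
    by exists j => //; exact: leqW.
  by exists m => //; rewrite ltW//=; have /andP[_] := step x m; lra.
have := drift j jn; have := cl j jn (v + u - time x j).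
rewrite subrK => clv dj.
have := locally_isometric_lipschitz (lineP (Phi y 0)) (v + u) (v + u - time x j + time y j).
have -> : v + u - (v + u - time x j + time y j) = - (time y j - time x j) by ring.
rewrite normrN => ly.
apply: le_lt_trans (metric_triangle _ (Phi y 0 (v + u - time x j + time y j)) _) _.
have {}clv : mdist (Phi y 0 (v + u - time x j + time y j)) (Phi x 0 (v + u)) < e1.
  apply: clv; move: vK; rewrite !ler_norml => /andP[? ?].
  by apply/andP; split; lra.
by move: ly dj clv; lra.
Qed.

End shadowing.

(** * Weak specification *)

Unset Implicit Arguments.

Theorem theorem3p3 (R : realType) (X Xt : metricType R) (p : Xt -> X)
    (A : finType) (W : seq (seq A)) :
  compact [set: X] ->
  locally_CAT0 X ->
  geodesic_space X ->
  universal_cover p ->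
  (forall x0 : X, ~ pi1_isomorphic_Z R x0) ->
  topologically_transitive (geodesic_flow p) ->
  (exists h : Susp R W -> GX p,
     orbit_semi_equivalence (susp_flow R W) (geodesic_flow p) h) ->
  weak_specification (dGX p) (geodesic_flow p).
Proof.
move=> cX lX gX p_cover _ trans [h hP] d d0.
have [r rP] := exists_CAT0_radius cX lX; have [r0 _] := rP.
have [N0 short] := short_orbit_arc p_cover cX gX hP rP.
pose q := N0.+1; have q0 : (0 < q)%N by [].
have [k1 k10 k1P] := orbit_time_lower p_cover cX gX hP rP q0 short.
have [N shadow] := orbit_shadow p_cover cX gX hP rP q0 short d0.
have [c0|nGX] := pselect (inhabited (GX p)); last first.
  by exists 1 => // k x; case: nGX; exact: inhabits (x 0%N).
have {c0}[u uP] : exists u, forall c : GX p,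
    exists x s, [/\ in_class u x, 0 <= s <= 1 & c = orbit_line h x s].
  by case: c0 => c0; exact: (transitive_one_class p_cover cX gX hP trans rP q0 short c0).
have [M concat] := sft_concat u N.
pose rho := q%:R * (r / 8).
have rho0 : 0 <= rho by rewrite mulr_ge0//; lra.
have time_unit n x : orbit_time h q x (n * q) <= n%:R * rho.
  by rewrite mulrA -natrM; exact: (orbit_time_upper hP rP q0 short).
have qtime x : orbit_time h q x q <= rho.
  by have := time_unit 1%N x; rewrite mul1n mul1r.
(* A connecting time consists of the surplus at the end of a word, at most [2 + rho], the gap, at
   most [M%:R * rho], and the offset of the next point, at most [rho]. *)
exists (2 + 2 * rho + M%:R * rho) => [|k x t k_ge1 t_ge0].
  have Mrho : 0 <= M%:R * rho by exact: mulr_ge0.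
  by lra.
(* Words are indexed from 0 and points from 1. A point lies at an offset [sg j] inside the first
   unit of its sequence. *)
have /choice[xs /choice[sg xsP]] : forall j : nat, exists z, exists s,
    [/\ in_class u z, 0 <= s <= rho & x j.+1 = geodesic_flow p s (orbit_line h z 0)].
  move=> j; have [z [s [uz s01 xE]]] := uP (x j.+1).
  have [_ _ _] := orbit_arc_time hP rP q0 short z q.
  rewrite tick_unit//.
  move=> /(_ s s01)[s' /andP[s'0 s'T] sE]; exists z, s'; split=> //.
    by rewrite s'0 (le_trans s'T).
  by rewrite xE sE.
(* The summand 1 compensates the lag of [orbit_shadow] and keeps connecting times nonnegative;
   minimality of the number of units limits the excess to [rho]. *)
have /choice[n nP] : forall j : nat, exists n : nat, (j < k)%N ->
    sg j + t j.+1 + 1 <= orbit_time h q (xs j) (n * q) <= sg j + t j.+1 + 1 + rho.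
  move=> j; have [jk|] := boolP (j < k)%N; last by exists 0%N.
  have [_ /andP[sg0 _] _] := xsP j; have tj : 0 <= t j.+1 by apply: t_ge0; rewrite jk.
  have ex : exists n, sg j + t j.+1 + 1 <= orbit_time h q (xs j) (n * q).
    exists (Num.truncn ((sg j + t j.+1 + 1) / k1)).+1; apply: le_trans (orbit_time_units q0 _ _ k1P).
    by rewrite -ler_pdivrMr// ltW// truncnS_gt.
  case: (ex_minnP ex) => -[|n] nP nmin; first by move: nP; rewrite mul0n orbit_time0; lra.
  exists n.+1 => _; rewrite nP /= mulSnr orbit_timeD// lerD//.
  by rewrite ltW// ltNge; apply/negP => /nmin; rewrite ltnn.
have k1E : k = k.-1.+1 by rewrite prednK.
have [y [pos [gapP wordP]]] := concat xs n k.-1 (fun j => let: And3 uz _ _ := xsP j in uz).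
(* The time at which the orbit of [y] begins to follow [x j.+1]. *)
pose start j := orbit_time h q y (pos j * q) + sg j.
pose ys j := sft_power (pos j) y.
have shadowP j : (j < k)%N -> 
    orbit_time h q (xs j) (n j * q) <= orbit_time h q (ys j) (n j * q) + 1 /\
    orbit_time h q (ys j) (n j * q) <= orbit_time h q (xs j) (n j * q) + 1 /\
    forall v, 0 <= v <= orbit_time h q (xs j) (n j * q) ->
      dGX p (geodesic_flow p v (orbit_line h (ys j) 0))
            (geodesic_flow p v (orbit_line h (xs j) 0)) < d.
  move=> jk; apply: shadow => m mN; rewrite /ys -(wordP j _ m mN); last by rewrite -ltnS -k1E.
  by rewrite /= /Defs.shift addrC.
have flow_start j v : geodesic_flow p (v + start j) (orbit_line h y 0) =
    geodesic_flow p (v + sg j) (orbit_line h (ys j) 0).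
  rewrite -[0 in RHS](tick0 q) -orbit_line_tick// addn0 (orbit_line_time hP rP q0 short).
  by rewrite geodesic_flowD /start; congr (geodesic_flow p _ _); ring.
pose tau i := if i is i'.+1 then start i - start i' - t i else 0.
exists (geodesic_flow p (start 0%N) (orbit_line h y 0)), tau; split=> //.
- move=> [|j]//= jk; have jk' : (j < k)%N by exact: ltnW.
  have [gap gapM gapE] := gapP j ltac:(by rewrite -ltnS -k1E).
  have [s1 [s2 _]] := shadowP j jk'; have /andP[n1 n2] := nP j jk'.
  have [_ /andP[sg0 sg1] _] := xsP j.+1; have [_ /andP[sg0' _] _] := xsP j.
  have gap1 := time_unit gap (sft_power (n j) (ys j)).
  have gap0 := orbit_time_le hP rP q0 short (sft_power (n j) (ys j)) (leq0n (gap * q)).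
  rewrite orbit_time0 in gap0.
  have gapM' : gap%:R * rho <= M%:R * rho by rewrite ler_wpM2r// ler_nat.
  rewrite /start gapE !mulnDl -addnA !orbit_timeD// -/(ys j).
  by apply/andP; split; lra.
- move=> [|j]//= jk v /andP[v0 vt]; rewrite geodesic_flowD.
  (* The sums telescope, and [start 0] is restored by the choice of the shadowing point. *)
  have -> : \sum_(1 <= i < j.+1) t i + \sum_(1 <= i < j) tau i + tau j = start j - start 0%N.
    elim: j {jk v0 vt} => [|j IH]; first by rewrite !big_geq// subrr !addr0.
    rewrite big_nat_recr//=.
    have -> : \sum_(1 <= i < j.+1) tau i = \sum_(1 <= i < j) tau i + tau j.
      by case: j {IH} => [|j]; [rewrite !big_geq// add0r|rewrite big_nat_recr].
    move: IH; move: (\sum_(_ <= i < _) t i) (\sum_(_ <= i < _) tau i) => a b; lra.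
  rewrite geodesic_flowD (_ : start 0%N + _ = v + start j); last by ring.
  have [_ /andP[sg0 _] xE] := xsP j; rewrite flow_start xE geodesic_flowD addrC.
  have [_ [_]] := shadowP j jk; apply; have /andP[n1 _] := nP j jk.
  by apply/andP; split; lra.
Qed.
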